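(* Let $(W,W')$ be an exchangeable pair of real random variables, let $\Delta = W-W'$, and suppose that $$E(W-W'\mid W) = 1/c_0 + r(W)$$ for a constant $c_0>0$ and a measurable function $r$. Let $Y$ have the exponential distribution with mean $1$. (i) If $h$ is absolutely continuous with $\|h'\|=\sup_x|h'(x)|<\infty$, then $$|Eh(W)-Eh(Y)| \le \|h'\|\big\{E\big|1-(c_0/2)E(\Delta^2\mid W)\big| + c_0E|\Delta|^3 + 3c_0E|W r(W)|\big\}.$$ (ii) If $|\Delta|\le\delta$ for some constant $\delta$, then for all real $z$, $$|P(W\le z)-P(Y\le z)| \le 3E\big|1-(c_0/2)E(\Delta^2\mid W)\big| + \delta + 2c_0\delta^3 + 3c_0E|Wr(W)|.$$
   Context: A pair $(W,W')$ is exchangeable if $(W,W')$ and $(W',W)$ have the same joint distribution. *)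

(* Defs.v *)
From HB Require Import structures.
From mathcomp Require Import all_boot all_order all_algebra.
From mathcomp Require Import all_classical all_reals all_analysis.
Set Implicit Arguments. Unset Strict Implicit. Unset Printing Implicit Defensive.
Import Order.TTheory GRing.Theory Num.Theory.
Local Open Scope classical_set_scope.
Local Open Scope ring_scope.

Definition cond_exp_given {d} {T : measurableType d} {R : realType}
  (P : probability T R) (X Z : T -> R) (g : R -> R) : Prop :=
  [/\ measurable_fun setT g,
      P.-integrable setT (fun t => (Z t)%:E),
      P.-integrable setT (fun t => (g (X t))%:E) &
      forall B : set R, measurable B ->
        (\int[P]_(t in X @^-1` B) (Z t)%:E =
         \int[P]_(t in X @^-1` B) (g (X t))%:E)%E].

Definition exchangeable {d} {T : measurableType d} {R : realType}
  (P : probability T R) (X Y : T -> R) : Prop :=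
  forall A : set (R * R), measurable A ->
    P ((fun t => (X t, Y t)) @^-1` A) = P ((fun t => (Y t, X t)) @^-1` A).

Definition abs_cont_R {R : realType} (h : R -> R) : Prop :=
  forall a b : R, forall e : R, 0 < e -> exists2 dl : R, 0 < dl &
    forall (n : nat) (x y : 'I_n -> R),
      (forall i, a <= x i /\ x i <= y i /\ y i <= b) ->
      (forall i j, i != j -> y i <= x j \/ y j <= x i) ->
      \sum_(i < n) (y i - x i) < dl ->
      \sum_(i < n) `|h (y i) - h (x i)| < e.

(* Main.v *)
(** Stein's method for the exponential law. A solution [f] of
    [f' - f = h - E h(Y)] with [f 0 = 0] turns the distance into
    [E (f'(W) - f(W))], and exchangeability together with the linear regression
    condition gives
    [E f(W) = c0/2 E D (f(W) - f(W')) - c0 E f(W) r(W)], where [D = W - W'].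
    Hence the distance is the sum of [E f'(W) (1 - c0/2 E(D^2 | W))], of a Taylor
    remainder and of [c0 E f(W) r(W)].

    For (i), [h] is Lipschitz because an absolutely continuous function is the
    integral of its derivative (total variation, Lebesgue-Stieltjes measure and
    Radon-Nikodym theorem), and [f w = H 0 - H w] with [H w = E h(w + Y)];
    memorylessness of [Y] gives the Taylor estimate with [f' = h - H] directly.
    For (ii), [f] is [w |-> e^(min(w - z, 0))] up to a constant; its kink at [z]
    costs [E D^2 1(W <= z < W')], bounded by applying the identity to the clamp
    of [w] to the window [z - delta, z + delta]. *)
Require Import Defs.
From HB Require Import structures.
From mathcomp Require Import all_boot all_order all_algebra.
From mathcomp Require Import all_classical all_reals all_analysis.
From mathcomp Require Import measurable_realfun.
From mathcomp Require Import ring lra.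
Set Implicit Arguments.
Unset Strict Implicit.
Unset Printing Implicit Defensive.
Import Order.TTheory GRing.Theory Num.Theory.
Import numFieldNormedType.Exports.
Local Open Scope classical_set_scope.
Local Open Scope ring_scope.

(** Neither [W], nor [W r(W)], nor [|D|^3] is known to be integrable. If [E |W r(W)|], or [E |D|^3]
    in (i), is infinite, the bound is trivial (apart from [M = 0]). Otherwise integrability of [W]
    is extracted from the exchangeable pair identity itself, applied to [min(|w|, n)]; this is why
    that identity is proved twice, for bounded and then for Lipschitz [f]. The normalisation
    [f 0 = 0] gives [|f w| <= L |w|], so that [E |W r(W)|] controls the drift term. In (i), [M]
    bounds the derivative of [h] only where it exists, so the Lipschitz bound rests on
    differentiation of an integral almost everywhere. Since [H' = H - h], the choice [f = H 0 - H]
    gives [f' - f = h - H 0] with [H 0 = E h(Y)]; as [h] may have corners, the remainder is not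
    estimated through a second derivative of [f]. In (ii), the two signs of the Taylor remainder are
    treated separately: each one pays only for crossings of [z] in one direction, and
    exchangeability makes the two costs equal. *)

(** * Families of segments and the variation of a function over them *)

Section segments.
Context {R : realType}.
Implicit Types (a b e dl : R) (h : R -> R) (s t : seq (R * R)).

(* A segment [x, y] is encoded as the pair (y, x), upper bound first, which is
   the convention of [variation_zip]. *)
Definition separated (p q : R * R) := (p.1 <= q.2) || (q.1 <= p.2).

Definition nonoverlapping s :=
  all (fun p => p.2 <= p.1) s && pairwise separated s.

Definition inside a b s := all (fun p => (a <= p.2) && (p.1 <= b)) s.

Definition seg_length s := \sum_(p <- s) (p.1 - p.2).

Definition seg_variation h s := \sum_(p <- s) `|h p.1 - h p.2|.

Lemma separatedC p q : separated p q = separated q p.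
Proof. by rewrite /separated orbC. Qed.

(** Lists replace families indexed by ['I_n] because the refinement of a family below is a
    concatenation. The weak bound [<= e] is the one that passes to the suprema in
    [total_variation_segments]. *)
Lemma abs_cont_segments a b h : abs_cont_R h -> forall e, 0 < e ->
  exists2 dl, 0 < dl & forall s, nonoverlapping s -> inside a b s ->
    seg_length s < dl -> seg_variation h s <= e.
Proof.
move=> hac e e0; have [dl dl0 H] := hac a b e e0; exists dl => // s.
move=> /andP[/allP s1 /pairwiseP s2] /allP s3 sdl.
apply: ltW; rewrite /seg_variation (big_nth (0, 0)) big_mkord.
apply: (H _ (fun i : 'I_(size s) => (nth (0, 0) s i).2)).
- move=> i; have i_s : nth (0, 0) s i \in s by exact: mem_nth.
  by move: (s1 _ i_s) (s3 _ i_s) => /= ? /andP[].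
- move=> i j ij.
  have [ij'|ij'|/val_inj ij'] := ltngtP i j.
  + by have /orP := s2 (0, 0) i j (ltn_ord i) (ltn_ord j) ij'.
  + have /orP := s2 (0, 0) j i (ltn_ord j) (ltn_ord i) ij'.
    by case=> ?; [right|left].
  + by rewrite ij' eqxx in ij.
- by move: sdl; rewrite /seg_length (big_nth (0, 0)) big_mkord.
Qed.

Lemma partition_inside a b (s : seq R) : itv_partition a b s ->
  inside a b (zip s (a :: s)).
Proof.
elim: s a => //= x s ih a abs; have := itv_partition_cons abs => xbs.
case: abs => /= /andP[ax _] _.
rewrite lexx (itv_partition_le xbs)/=.
by apply: sub_all (ih _ xbs) => p /andP[xp ->]; rewrite (le_trans (ltW ax)).
Qed.

Lemma partition_nonoverlapping a b (s : seq R) : itv_partition a b s ->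
  nonoverlapping (zip s (a :: s)).
Proof.
elim: s a => //= x s ih a abs; have := itv_partition_cons abs => xbs.
case: abs => /= /andP[ax _] _.
have /andP[s1 s2] := ih _ xbs.
rewrite /nonoverlapping/= ltW//= s1 s2 andbT/=.
by apply: sub_all (partition_inside xbs) => p /andP[xp _]; rewrite /separated xp.
Qed.

Lemma partition_length a b (s : seq R) : itv_partition a b s ->
  seg_length (zip s (a :: s)) = b - a.
Proof.
rewrite /seg_length; elim: s a => /= [a /itv_partition_nil ->|x s ih a abs].
  by rewrite big_nil subrr.
by rewrite big_cons (ih _ (itv_partition_cons abs))/= addrC subrKA.
Qed.

Lemma inside_separated a b s q : inside a b s -> separated (b, a) q ->
  all (fun p => separated p q) s.
Proof.
move=> sab /orP[/= bq|qa]; apply: sub_all sab => p /andP[ap pb].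
  by rewrite /separated (le_trans pb).
by rewrite /separated orbC (le_trans qa).
Qed.

(* The variations inside the segments of [s] are refined one segment at a time:
   a partition of the head of [s] is moved to [t]. *)
Lemma total_variation_segments a b h e dl :
  (forall s, nonoverlapping s -> inside a b s ->
    seg_length s < dl -> seg_variation h s <= e) ->
  forall s t, nonoverlapping (s ++ t) -> inside a b (s ++ t) ->
    seg_length (s ++ t) < dl ->
  (\sum_(p <- s) total_variation p.2 p.1 h + (seg_variation h t)%:E <= e%:E)%E.
Proof.
move=> H; elim=> [t|[y x] s ih t].
  by move=> ? ? ?; rewrite big_nil add0e lee_fin H.
rewrite /nonoverlapping /inside /= => /andP[/andP[xy st1] /andP[xyst st2]].
move=> /andP[/andP[ax yb] abst] dlst.
have step l : itv_partition x y l ->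
    (\sum_(p <- s) total_variation p.2 p.1 h
      + (seg_variation h (zip l (x :: l) ++ t))%:E <= e%:E)%E.
  move=> xyl; apply: ih.
  - move: st1 st2 xyst; rewrite !all_cat !pairwise_cat.
    move=> /andP[s1 t1] /and3P[stsep sp tp] /andP[xys xyt].
    have /andP[l1 l2] := partition_nonoverlapping xyl.
    have lin := partition_inside xyl.
    rewrite /nonoverlapping !all_cat !pairwise_cat s1 l1 t1 sp l2 tp/= andbT.
    rewrite allrel_catr stsep !andbT; apply/andP; split.
      apply/allrelP => p q ps ql; rewrite separatedC.
      have /allP := inside_separated lin (allP xys _ ps).
      exact.
    apply/allrelP => p q pl qt.
    have /allP := inside_separated lin (allP xyt _ qt).
    exact.
  - move: abst; rewrite /inside !all_cat => /andP[-> ->]; rewrite andbT/=.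
    apply: sub_all (partition_inside xyl) => p /andP[xp py].
    by rewrite (le_trans ax)// (le_trans py).
  - apply: le_lt_trans dlst; rewrite /seg_length big_cons !big_cat/=.
    by rewrite -!/(seg_length _) (partition_length xyl) addrCA.
rewrite big_cons/=.
(* Moving this sum across an inequality requires its finiteness; [step] at any single partition of
   [[x, y]] provides it. *)
have sfin : (\sum_(p <- s) total_variation p.2 p.1 h)%E \is a fin_num.
  have [l xyl] : exists l, itv_partition x y l.
    move: xy; rewrite le_eqVlt => /predU1P[->|xy].
      by exists [::]; split.
    by exists [:: y]; exact: itv_partition1.
  rewrite ge0_fin_numE; last first.
    rewrite big_seq; apply: sume_ge0 => p ps; apply: total_variation_ge0.
    by apply: (allP st1); rewrite mem_cat ps.
  rewrite -(@lteD2rE _ (seg_variation h (zip l (x :: l) ++ t))%:E)//.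
  by rewrite (le_lt_trans (step _ xyl))// ltry.
set V := total_variation x y h.
suff : (V <= e%:E - (\sum_(p <- s) total_variation p.2 p.1 h
                    + (seg_variation h t)%:E))%E.
  rewrite leeBrDr; last by rewrite fin_numD sfin.
  by rewrite addeA.
apply: ge_ereal_sup => _ [_ [l xyl <-] <-].
rewrite leeBrDr; last by rewrite fin_numD sfin.
apply: le_trans (step _ xyl).
rewrite addeCA leeD2l// /seg_variation big_cat/= EFinD.
by rewrite (variation_zip _ xyl).
Qed.

End segments.

(** * Lebesgue-Stieltjes measures dominated by Lebesgue measure, and their densities *)

Section density_of_absolutely_continuous_functions.
Context {R : realType}.
Local Notation mu := (@lebesgue_measure R).

(** Meant for the components of an open set. The half-open hull has an explicit Stieltjes measure,
    while the open core contained in [I] prevents the hulls of disjoint components from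
    overlapping. *)
Lemma open_interval_bounds (I : set R) : open I -> is_interval I ->
  I !=set0 -> (mu I < +oo)%E ->
  exists p : R * R, [/\ p.2 < p.1, I `<=` `]p.2, p.1],
    `]p.2, p.1[ `<=` I & mu I = (p.1 - p.2)%:E].
Proof.
move=> oI /is_intervalP + [w Iw] muI; move: (Rhull I) => i Ii.
have muIE : mu I = if (i.1 < i.2)%E then (i.2 - i.1)%E else 0%E.
  by rewrite [in LHS]Ii lebesgue_measure_itv.
have below v : I v -> exists2 v', I v' & v' < v.
  move=> Iv; have /nbhs_ballP[e /= e0 ve] : nbhs v I by exact: open_nbhs_nbhs.
  exists (v - e / 2); last by rewrite ltrBlDr ltrDl divr_gt0.
  by apply: ve; rewrite /ball/= opprB addrC subrK gtr0_norm; lra.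
move: muIE; case: i Ii => [[b1 x|b1] [b2 y|b2]] Ii.
- have xw v : I v -> x < v <= y.
    move=> Iv; have [v' + v'v] := below _ Iv; move: Iv; rewrite Ii /= !itv_boundlr.
    by case: b1 {Ii}; case: b2; rewrite !bnd_simp => /andP[? ?] /andP[? ?];
      apply/andP; split; lra.
  have /andP[xw1 xw2] := xw _ Iw; have xy : x < y by exact: lt_le_trans xw2.
  rewrite /= lte_fin xy => muE; exists (y, x); split => //=.

  rewrite Ii => v /=; rewrite !itv_boundlr.
  by case: b1 {Ii}; case: b2; rewrite !bnd_simp => /andP[? ?];
      apply/andP; split; lra.
(* In the remaining cases an infinite bound contradicts the finite measure or, when it is on the
   wrong side, the membership of [w]. *)
- move: muI; rewrite {1}Ii lebesgue_measure_itv/=; case: b2 Ii => Ii /=.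
    by move: Iw; rewrite Ii/= itv_boundlr => /andP[_]; case: b1 {Ii}.
  by rewrite ltry.
- move: muI; rewrite {1}Ii lebesgue_measure_itv/=; case: b1 Ii => Ii /=.
    by rewrite ltNyr.
  by move: Iw; rewrite Ii/= itv_boundlr.
- move: muI; rewrite {1}Ii lebesgue_measure_itv/=; case: b1 Ii => Ii /=; last first.
    by move: Iw; rewrite Ii/= itv_boundlr.
  case: b2 Ii => Ii //=.
  by move: Iw; rewrite Ii/= itv_boundlr => /andP[_].
Qed.

Lemma lebesgue_stieltjes_measure_oc (F : cumulative R R) (x y : R) : x <= y ->
  lebesgue_stieltjes_measure F `]x, y] = (F y - F x)%:E.
Proof.
move=> xy; rewrite /lebesgue_stieltjes_measure /measure_extension/=.
by rewrite measurable_mu_extE/= ?wlength_itv_bnd//; exact: is_ocitv.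
Qed.

(** Global, where [abs_cont_R] is local to a segment: it is meant for functions precomposed with
    [clamp a b], hence constant off [[a, b]]. *)
Definition absolutely_continuous (G : R -> R) := forall e : R, 0 < e ->
  exists2 dl : R, 0 < dl & forall s, nonoverlapping s ->
    seg_length s < dl -> seg_variation G s <= e.

Lemma absolutely_continuous_continuous (G : R -> R) :
  absolutely_continuous G -> continuous G.
Proof.
move=> acG x; apply/cvgrPdist_le => e e0; have [dl dl0 H] := acG e e0.
near=> y.
have yx : `|x - y| < dl by near: y; apply: cvgr_dist_lt => //.
pose s := [:: (Num.max x y, Num.min x y)].
have := H s; rewrite /nonoverlapping/= !andbT ge_min le_max lexx.
rewrite /seg_length /seg_variation !big_seq1/=.
have [xy|yx'] := leP x y.
  by rewrite distrC => -> //; rewrite (le_lt_trans _ yx)// distrC ler_norm.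
by move=> -> //; rewrite (le_lt_trans _ yx)// ler_norm.
Unshelve. all: by end_near. Qed.

(** A null set lies in an open set of Lebesgue measure less than [dl]. Finitely many components of
    that open set form a nonoverlapping family of total length below [dl], over which [F] varies by
    at most [e]; countable additivity passes to all components. *)
Lemma lebesgue_stieltjes_dominated (F : cumulative R R) :
  absolutely_continuous F -> lebesgue_stieltjes_measure F `<< mu.
Proof.
move=> acF; apply/null_content_dominatesP => A mA muA.
apply/eqP; rewrite -measure_le0; apply/lee_addgt0Pr => e e0; rewrite add0e.
have [dl dl0 H] := acF e e0.
have [|U [oU AU]] := lebesgue_regularity_outer mA _ dl0; first by rewrite muA.
have mU : measurable U by exact: open_measurable.
have muUE : mu (U `\` A) = mu U.
  rewrite [in RHS](_ : U = (U `\` A) `|` A); last by rewrite setUC setDUK.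
  by rewrite measureU0//; exact: measurableD.
move=> muUA; have {muUA}muU : (mu U < dl%:E)%E by rewrite -muUE.
apply: (@le_trans _ _ (lebesgue_stieltjes_measure F U)).
  by rewrite le_measure ?inE.
pose I := open_disjoint_itv oU.
have mI k : measurable (I k).
  by apply: open_measurable; exact: open_disjoint_itv_open.
have tI : trivIset setT I by exact: open_disjoint_itv_trivIset.
have UI : U = \bigcup_k I k by exact: open_disjoint_itv_bigcup.
have muI k : (mu (I k) < +oo)%E.
  apply: (@le_lt_trans _ _ (mu U)); last exact: lt_trans (ltry dl).
  apply: le_measure; rewrite ?inE; [exact: mI|exact: mU|].
  by move=> z Iz; rewrite UI; exists k.
have /choice[p pP] k : exists p : R * R, I k !=set0 ->
    [/\ p.2 < p.1, I k `<=` `]p.2, p.1],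
    `]p.2, p.1[ `<=` I k & mu (I k) = (p.1 - p.2)%:E].
  have [Ik0|Ik0] := pselect (I k !=set0); last by exists (0, 0).
  have [p pP] := open_interval_bounds (@open_disjoint_itv_open _ _ oU k)
    (@open_disjoint_itv_is_interval _ _ oU k) Ik0 (muI k).
  by exists p.
have -> : (lebesgue_stieltjes_measure F U =
    \sum_(0 <= i <oo | i \in setT) lebesgue_stieltjes_measure F (I i))%E.
  rewrite {1}UI; apply: measure_bigcup => [k _|]; [exact: mI|exact: tI].
apply: lime_le.
  by apply: is_cvg_nneseries => // n _ _; exact: measure_ge0.
apply: nearW => n.
(* Empty components have no hull and contribute 0 to both measures, so they are dropped. *)
pose r := [seq k <- iota 0 n | `[< I k !=set0 >]].
have rI k : k \in r -> I k !=set0 by rewrite mem_filter => /andP[/asboolP].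
have sumE (m : set R -> \bar R) : m set0 = 0%E ->
    (\sum_(0 <= i < n | i \in setT) m (I i) = \sum_(i <- r) m (I i))%E.
  move=> m0; rewrite /r big_filter /index_iota subn0 [RHS]big_mkcond [LHS]big_mkcond/=.
  apply: eq_bigr => i _; rewrite in_setT; case: asboolP => // Ii.
  by have [->|/set0P//] := eqVneq (I i) set0; rewrite m0.
rewrite (sumE (lebesgue_stieltjes_measure F)); last exact: measure0.
have s_ok : nonoverlapping [seq p k | k <- r].
  apply/andP; split.
    by apply/allP => _ /mapP[k /rI kr ->]; have [/ltW] := pP _ kr.
  rewrite pairwise_map.
  apply: (@sub_in_pairwise _ (fun k => k \in r) (fun i j => i != j)).
  - move=> i j /rI/pP[pi1 _ pi2 _] /rI/pP[pj1 _ pj2 _] ij /=.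
    rewrite /separated leNgt [X in _ || X]leNgt -negb_and.
    apply/negP => /andP[ij1 ij2].
    (* If two hulls overlapped, the midpoint of the overlap would belong to two disjoint
       components. *)
    pose lo := Num.max (p i).2 (p j).2; pose hi := Num.min (p i).1 (p j).1.
    have lohi : lo < hi.
      by rewrite /lo /hi gt_max !lt_min; do 2 (apply/andP; split); lra.
    pose v := (lo + hi) / 2.
    have /andP[v1 v2] : lo < v < hi by rewrite /v; apply/andP; split; lra.
    move: v1 v2; rewrite gt_max lt_min => /andP[v1 v2] /andP[v3 v4].
    move/trivIsetP : tI => /(_ i j Logic.I Logic.I ij).
    rewrite -subset0 => /(_ v); apply; split.
      by apply: pi2; rewrite /= in_itv/= v1.
    by apply: pj2; rewrite /= in_itv/= v2.
  - exact/allP.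
  - by rewrite -uniq_pairwise filter_uniq// iota_uniq.
have len_dl : seg_length [seq p k | k <- r] < dl.
  rewrite -lte_fin; apply: le_lt_trans muU.
  rewrite /seg_length big_map -sumEFin.
  rewrite (_ : (\sum_(i <- r) _ = \sum_(i <- r) mu (I i))%E); last first.
    by apply: eq_big_seq => k /rI/pP[_ _ _ ->].
  rewrite -(sumE mu) ?measure0// {1}UI.
  have -> : (mu (\bigcup_k I k) = \sum_(0 <= i <oo | i \in setT) mu (I i))%E.
    by apply: measure_bigcup => [k _|]; [exact: mI|exact: tI].
  by apply: nneseries_lim_ge => k _ _; exact: measure_ge0.
apply: (@le_trans _ _ (seg_variation F [seq p k | k <- r])%:E); last first.
  by rewrite lee_fin; exact: H.
rewrite /seg_variation big_map -sumEFin big_seq [leRHS]big_seq.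
apply: lee_sum => k /rI/pP[/ltW p1 p2 _ _].
apply: (@le_trans _ _ (lebesgue_stieltjes_measure F `](p k).2, (p k).1])).
  by apply: le_measure; rewrite ?inE; [exact: mI|exact: measurable_itv|].
by rewrite lebesgue_stieltjes_measure_oc// lee_fin ler_norm.
Qed.

(** The density is the Radon-Nikodym derivative of the Stieltjes measure of [G] restricted to []a,
    b]]; the restriction makes that measure finite, hence the density integrable on the whole
    line. *)
Lemma nondecreasing_absolutely_continuous_density (G : R -> R) (a b : R) :
  {homo G : x y / x <= y} -> absolutely_continuous G -> a <= b ->
  exists2 f : R -> R, mu.-integrable setT (EFin \o f) &
    forall x y, a <= x -> x <= y -> y <= b ->
      G y - G x = \int[mu]_(t in `]x, y]) f t.
Proof.
move=> ndG acG ab.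
have rcG : right_continuous G.
  exact/right_continuousW/absolutely_continuous_continuous.
pose F : cumulative R R := HB.pack G (isCumulative.Build R _ R G ndG rcG).
have mab : measurable (`]a, b]%classic : set (measurableTypeR R)).
  exact: measurable_itv.
have fab : (lebesgue_stieltjes_measure F `]a, b] < +oo)%E.
  by rewrite lebesgue_stieltjes_measure_oc// ltry.
pose nu : {finite_measure set (measurableTypeR R) -> \bar R} := mfrestr mab fab.
have numu : nu `<< mu.
  have := @lebesgue_stieltjes_dominated F acG.
  move=> /null_content_dominatesP H; apply/null_content_dominatesP => A mA muA0.
  apply/eqP; rewrite -measure_le0 -(H A mA muA0).
  by rewrite /nu/= /mfrestr /mrestr le_measure ?inE//; exact: measurableI.
pose f := Radon_Nikodym_SigmaFinite.f nu mu.
have ffin x : f x \is a fin_num by exact: Radon_Nikodym_SigmaFinite.f_fin_num.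
exists (fine \o f).
  have := Radon_Nikodym_SigmaFinite.f_integrable numu.
  by apply: eq_integrable => // x _ /=; rewrite fineK.
move=> x y ax xy yb; rewrite /Rintegral.
under eq_integral do rewrite fineK//.
rewrite -(Radon_Nikodym_SigmaFinite.f_integral numu); last exact: measurable_itv.
rewrite /nu/= /mfrestr /mrestr setIidl; last first.
  by move=> z /=; rewrite !in_itv/= => /andP[xz zy];
    rewrite (le_lt_trans ax)// (le_trans zy).
by rewrite lebesgue_stieltjes_measure_oc.
Qed.

End density_of_absolutely_continuous_functions.

(** * Absolutely continuous functions with bounded derivative are Lipschitz *)

Section absolutely_continuous_lipschitz.
Context {R : realType}.
Local Notation mu := (@lebesgue_measure R).
Implicit Types (a b x y M : R) (h : R -> R).

(** This projection has three uses: making functions constant off a segment, truncating Lipschitz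
    test functions, and serving as the test function that detects crossings of a level. *)
Definition clamp a b x := Num.max a (Num.min x b).

Lemma clamp_ge a b x : a <= clamp a b x.
Proof. by rewrite /clamp le_max lexx. Qed.

Lemma clamp_le a b x : a <= b -> clamp a b x <= b.
Proof. by move=> ab; rewrite /clamp ge_max ab ge_min lexx orbT. Qed.

Lemma clamp_id a b x : a <= x -> x <= b -> clamp a b x = x.
Proof. by move=> ax xb; rewrite /clamp min_l// max_r. Qed.

Lemma clamp_homo a b : {homo clamp a b : x y / x <= y}.
Proof.
move=> x y xy; rewrite /clamp ge_max le_max lexx/=.
by rewrite le_max le_min !ge_min xy lexx !orbT.
Qed.

Lemma clamp_lip a b x y : `|clamp a b x - clamp a b y| <= `|x - y|.
Proof.
wlog xy : x y / x <= y.
  by move=> H; have [/H//|/ltW/H] := leP x y; rewrite distrC (distrC y).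
rewrite distrC ger0_norm ?subr_ge0 ?clamp_homo// distrC.
rewrite (le_trans _ (ler_norm _))// lerBlDr [X in X <= _]/clamp ge_max.
have xa := clamp_ge a b x; apply/andP; split; first lra.
have xb : Num.min x b <= clamp a b x by rewrite /clamp le_max lexx orbT.
apply: le_trans (lerD (lexx _) xb).
by case: (leP x b) => ?; case: (leP y b) => ?; lra.
Qed.

Lemma inside_clamp a b s : a <= b ->
  inside a b [seq (clamp a b p.1, clamp a b p.2) | p <- s].
Proof.
by move=> ab; apply/allP => _ /mapP[p _ ->]/=; rewrite clamp_ge clamp_le.
Qed.

Lemma nonoverlapping_clamp a b s : nonoverlapping s ->
  nonoverlapping [seq (clamp a b p.1, clamp a b p.2) | p <- s].
Proof.
move=> /andP[s1 s2]; apply/andP; split.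
  by apply/allP => _ /mapP[p /(allP s1) ? ->] /=; exact: clamp_homo.
rewrite pairwise_map; apply: sub_pairwise s2 => p q /orP[pq|qp].
  by rewrite /separated/= clamp_homo.
by rewrite /separated/= orbC clamp_homo.
Qed.

Lemma seg_length_clamp a b s : nonoverlapping s ->
  seg_length [seq (clamp a b p.1, clamp a b p.2) | p <- s] <= seg_length s.
Proof.
move=> /andP[/allP s1 _]; rewrite /seg_length big_map big_seq [leRHS]big_seq.
apply: ler_sum => p /s1 /= p21.
by rewrite -(ger0_norm (_ : 0 <= p.1 - p.2)) ?subr_ge0// (le_trans (ler_norm _))// clamp_lip.
Qed.

Lemma absolutely_continuousB (F G : R -> R) : absolutely_continuous F ->
  absolutely_continuous G -> absolutely_continuous (F \- G).
Proof.
move=> acF acG e e0.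
have e20 : 0 < e / 2 by rewrite divr_gt0.
have [d1 d10 H1] := acF _ e20; have [d2 d20 H2] := acG _ e20.
exists (Num.min d1 d2); first by rewrite lt_min d10.
move=> s ns; rewrite lt_min => /andP[s1 s2].
rewrite [e]splitr; apply: le_trans (lerD (H1 s ns s1) (H2 s ns s2)).
rewrite /seg_variation -big_split/=; apply: ler_sum => p _.
rewrite [X in `|X|](_ : _ = (F p.1 - F p.2) - (G p.1 - G p.2)); last by ring.
exact: ler_normB.
Qed.

(** Jordan decomposition: on [[a, b]], [h] is the difference of its variation [g] and of [g - h],
    both nondecreasing and absolutely continuous, so each of them has a density. *)
Lemma absolutely_continuous_density a b h : a < b -> abs_cont_R h ->
  (total_variation a b h < +oo)%E ->
  exists2 f : R -> R, mu.-integrable setT (EFin \o f) &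
    forall x, a <= x -> x <= b -> h x = h a + \int[mu]_(t in `]a, x]) f t.
Proof.
move=> ab hac TVoo; have ab' := ltW ab.
pose c := clamp a b; pose hc x := h (c x).
pose g x := fine (total_variation a (c x) h).
have TVfin x y : a <= x -> x <= y -> y <= b ->
    total_variation x y h \is a fin_num.
  move=> ax xy yb; rewrite ge0_fin_numE ?total_variation_ge0//.
  apply: le_lt_trans TVoo; rewrite (total_variationD h ax (le_trans xy yb)).
  rewrite (total_variationD h xy yb) addeCA leeDl// adde_ge0//.
    exact: total_variation_ge0.
  exact: total_variation_ge0.
have gB x y : x <= y -> g y - g x = fine (total_variation (c x) (c y) h).
  move=> xy; rewrite /g.
  rewrite (@total_variationD _ a (c y) (c x)) ?clamp_ge ?clamp_homo//.
  rewrite fineD ?TVfin ?clamp_ge ?clamp_le ?clamp_homo//.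
  by rewrite addrC addKr.
have ndg : {homo g : x y / x <= y}.
  move=> x y xy; rewrite -subr_ge0 gB// fine_ge0// total_variation_ge0//.
  exact: clamp_homo.
have ndq : {homo (g \- hc) : x y / x <= y}.
  move=> x y xy /=; rewrite -subr_ge0.
  have -> : g y - hc y - (g x - hc x) = (g y - g x) - (hc y - hc x) by ring.
  rewrite gB// subr_ge0 (le_trans (ler_norm _))// -lee_fin fineK.
    by apply: total_variation_ge; exact: clamp_homo.
  by rewrite TVfin ?clamp_ge ?clamp_le ?clamp_homo.
have achc : absolutely_continuous hc.
  move=> e e0; have [dl dl0 H] := abs_cont_segments a b hac e0.
  exists dl => // s ns sdl.
  have := H _ (nonoverlapping_clamp a b ns) (inside_clamp s ab').
  rewrite /seg_variation big_map; apply.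
  exact: le_lt_trans (seg_length_clamp _ _ ns) sdl.
(* Increments of [g] are total variations of [h], so control of the increments of [h] is not enough
   here; [total_variation_segments] supplies the stronger control. *)
have acg : absolutely_continuous g.
  move=> e e0; have [dl dl0 H] := abs_cont_segments a b hac e0.
  exists dl => // s ns sdl.
  have := total_variation_segments H.
  move=> /(_ [seq (c p.1, c p.2) | p <- s] [::]); rewrite cats0.
  move=> /(_ (nonoverlapping_clamp a b ns) (inside_clamp s ab')).
  move=> /(_ (le_lt_trans (seg_length_clamp _ _ ns) sdl)).
  rewrite /seg_variation big_nil adde0 big_map -lee_fin; apply: le_trans.
  rewrite -sumEFin big_seq [leRHS]big_seq; apply: lee_sum => p ps.
  have /andP[/allP/(_ p ps)/= p21 _] := ns.
  rewrite gB// ger0_norm; last first.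
    by rewrite fine_ge0// total_variation_ge0//; exact: clamp_homo.
  by rewrite fineK// TVfin ?clamp_ge ?clamp_le ?clamp_homo.
have [f1 if1 f1E] := nondecreasing_absolutely_continuous_density ndg acg ab'.
have acq := absolutely_continuousB acg achc.
have [f2 if2 f2E] := nondecreasing_absolutely_continuous_density ndq acq ab'.
exists (fun x => f1 x - f2 x).
  have : mu.-integrable setT ((EFin \o f1) \- (EFin \o f2))%E.
    exact: integrableB.
  by apply: eq_integrable.
move=> x ax xb.
have sub : `]a, x]%classic `<=` [set: R] by [].
have mI : measurable (`]a, x]%classic : set R) by exact: measurable_itv.
rewrite RintegralB//; [|exact: integrableS if1|exact: integrableS if2].
rewrite -f1E// -f2E//=.
by rewrite /hc /c !clamp_id//; ring.
Qed.

(** At almost every point of []a, b[] the integral of [f] is differentiable with derivative [f x].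
    There [h] is differentiable as well, so the hypothesis on [M] bounds [f], and integrating this
    bound concludes. *)
Lemma derivative_bound_density a b h M (f : R -> R) : a < b ->
  (forall x, derivable h x 1 -> `|derive1 h x| <= M) ->
  mu.-integrable setT (EFin \o f) ->
  (forall x, a <= x -> x <= b -> h x = h a + \int[mu]_(t in `]a, x]) f t) ->
  `|h b - h a| <= M * (b - a).
Proof.
move=> ab hM intf hE.
have intfS (i : interval R) : mu.-integrable [set` i] (EFin \o f).
  by apply: (integrableS measurableT) => //; exact: measurable_itv.
have lf : locally_integrable setT f.
  by apply: open_integrable_locally => //; exact: openT.
have fM : {ae mu, forall x, `]a, b[%classic x -> `|f x| <= M}.
  have := FTC1 (fun y => intfS (Interval (BRight a) (BRight y))) lf.
  apply: filterS; first exact: (ae_filter_ringOfSetsType mu).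
  move=> x Fx /=; rewrite in_itv/= => /andP[ax xb].
  have [dF Fxf] := Fx ax.
  set F := fun x => _ in dF Fxf *.
  (* [h] is known to be a primitive only on [[a, b]]; as [x] is interior, agreement near [x]
     suffices to transfer the derivative. *)
  have hF : {near x, (F + cst (h a)) =1 h}.
    near=> y; change (F y + h a = h y).
    have ay : a <= y by near: y; exact: lt_le_nbhsr.
    have yb : y <= b by near: y; exact: lt_le_nbhsl.
    by rewrite (hE y ay yb) addrC.
  have F' : is_derive x 1 F (f x).
    by apply: DeriveDef; [exact: dF|rewrite -derive1E; exact: Fxf].
  clearbody F.
  have Fh' : is_derive x 1 (F + cst (h a)) (f x + 0).
    exact: is_deriveD F' (is_derive_cst (h a) x 1).
  have [dh h'] := near_eq_is_derive hF Fh'.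
  by rewrite -[f x]addr0 -h' -derive1E; exact: hM.
(* With [M < 0] the almost sure bound would fail at every point of []a, b[], which would then be
   negligible. *)
have M0 : 0 <= M.
  rewrite leNgt; apply/negP => M0.
  have ng : mu.-negligible `]a, b[%classic.
    apply: negligibleS fM => x xab /=; rewrite not_implyE; split => //.
    by apply/negP; rewrite -ltNge (lt_le_trans M0).
  have : mu (`]a, b[%classic : set R) = 0%E.
    by apply: (iffLR (negligibleP _ _) ng); exact: measurable_itv.
  by rewrite lebesgue_measure_itv/= lte_fin ab => -[]; lra.
rewrite (hE b (ltW ab) (lexx b)) addrC addKr.
rewrite -Rintegral_itv_bndo_bndc; last exact: intfS.
rewrite -lee_fin EFin_normr_Rintegral; [|exact: measurable_itv|exact: intfS].
have mf : measurable_fun `]a, b[ (EFin \o f) by case/integrableP: (intfS `]a, b[).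
apply: le_trans.
  by apply: le_abse_integral; [exact: measurable_itv|exact: mf].
apply: (@le_trans _ _ (\int[mu]_(x in `]a, b[) M%:E)%E).
  apply: ae_ge0_le_integral.
  - exact: measurable_itv.
  - by move=> x _; exact: abse_ge0.
  - exact: measurableT_comp.
  - by move=> x _; rewrite lee_fin.
  - exact: measurable_cst.
  - move: fM; apply: filterS; first exact: (ae_filter_ringOfSetsType mu).
    by move=> x xM /xM; rewrite lee_fin.
rewrite integral_cst; last exact: measurable_itv.
suff : (M%:E * mu (`]a, b[%classic : set R) <= (M * (b - a))%:E)%E by [].
by rewrite lebesgue_measure_itv/= lte_fin ab -EFinB -EFinM.
Unshelve. all: by end_near. Qed.

(* [h] has finite variation on short segments, so the estimate holds there; it
   adds up along a fine subdivision. *)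
Lemma abs_cont_lipschitz h M : abs_cont_R h ->
  (forall x, derivable h x 1 -> `|derive1 h x| <= M) ->
  0 <= M /\ forall x y, `|h x - h y| <= M * `|x - y|.
Proof.
move=> hac hM.
have main a b : a < b -> `|h b - h a| <= M * (b - a).
  (* The tolerance 1 is arbitrary: once the mesh is below [dl], the variation over each subinterval
     is at most 1, and only its finiteness matters. *)
  move=> ab; have [dl dl0 H] := abs_cont_segments a b hac ltr01.
  have [n /= ndl] : exists n : nat, (b - a) / n.+1%:R < dl.
    exists (Num.Def.archi_bound ((b - a) / dl)).
    rewrite ltr_pdivrMr// mulrC -ltr_pdivrMr//.
    rewrite (lt_le_trans (archi_boundP _)) ?ler_nat// divr_ge0 ?ltW// subr_gt0.
    exact: ab.
  pose x (k : nat) := a + (b - a) / n.+1%:R * k%:R.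
  have xS k : x k.+1 - x k = (b - a) / n.+1%:R.
    by rewrite /x -natr1; ring.
  have x0 : x 0%N = a by rewrite /x mulr0 addr0.
  have xn : x n.+1 = b by rewrite /x divfK ?pnatr_eq0// subrKC.
  have ba0 : 0 < (b - a) / n.+1%:R by rewrite divr_gt0// subr_gt0.
  have step k : (k < n.+1)%N -> `|h (x k.+1) - h (x k)| <= M * (x k.+1 - x k).
    move=> kn; have xk : x k < x k.+1 by rewrite -subr_gt0 xS.
    have TVk : (total_variation (x k) (x k.+1) h < +oo)%E.
      have := total_variation_segments H.
      move=> /(_ [:: (x k.+1, x k)] [::]) /=.
      rewrite /seg_length /seg_variation big_seq1 big_nil adde0 big_seq1 xS.
      rewrite /nonoverlapping /inside /= !andbT => /(_ (ltW xk)) V.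
      rewrite (le_lt_trans (V _ _))// ?ltry//; apply/andP; split.
        by rewrite /x lerDl mulr_ge0// ltW.
      by rewrite -xn /x lerD2l ler_wpM2l ?ler_nat// ltW.
    have [f intf fE] := absolutely_continuous_density xk hac TVk.
    exact: derivative_bound_density intf fE.
  rewrite -[in leLHS]xn -[in leLHS]x0 -[in leRHS]xn -[in leRHS]x0.
  rewrite -(telescope_sumr (h \o x))// -(telescope_sumr x)//= mulr_sumr.
  rewrite (le_trans (ler_norm_sum _ _ _))//.
  by rewrite big_nat [leRHS]big_nat ler_sum// => k /step.
have M0 : 0 <= M.
  have := main 0 1 ltr01; rewrite subr0 mulr1; exact: le_trans.
split=> // x y; have [xy|xy|->] := ltgtP x y.
- by rewrite distrC (le_trans (main _ _ xy))// ler_wpM2l// distrC ler_norm.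
- by rewrite (le_trans (main _ _ xy))// ler_wpM2l// ler_norm.
- by rewrite !subrr normr0 mulr0.
Qed.

End absolutely_continuous_lipschitz.

(** * Expectations and conditional expectations on a probability space *)

Section expectations.
Context {d : measure_display} {T : measurableType d} {R : realType}.
Variable P : probability T R.
Implicit Types f g h Z : T -> R.

Definition Pintegrable f := P.-integrable setT (EFin \o f).

Lemma Pintegrable_measurable f : Pintegrable f -> measurable_fun setT f.
Proof. by move=> /measurable_int/measurable_EFinP. Qed.

Lemma Pintegrable_le f g : measurable_fun setT f -> (forall t, `|f t| <= g t) ->
  Pintegrable g -> Pintegrable f.
Proof.
move=> mf fg; apply: le_integrable => //; first exact/measurable_EFinP.
by move=> t _ /=; rewrite lee_fin (le_trans (fg t))// ler_norm.
Qed.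

Lemma Pintegrable_cst (k : R) : Pintegrable (fun=> k).
Proof. exact: finite_measure_integrable_cst. Qed.

Lemma Pintegrable_bounded f (K : R) : measurable_fun setT f ->
  (forall t, `|f t| <= K) -> Pintegrable f.
Proof. by move=> mf fK; apply: (Pintegrable_le mf fK); exact: Pintegrable_cst. Qed.

Lemma PintegrableD f g : Pintegrable f -> Pintegrable g ->
  Pintegrable (fun t => f t + g t).
Proof. by move=> /(integrableD measurableT)/[apply]. Qed.

Lemma PintegrableZ (k : R) f : Pintegrable f -> Pintegrable (fun t => k * f t).
Proof. by move=> /(integrableZl measurableT k). Qed.

Lemma PintegrableB f g : Pintegrable f -> Pintegrable g ->
  Pintegrable (fun t => f t - g t).
Proof. by move=> /(integrableB measurableT)/[apply]. Qed.

Lemma Pintegrable_norm f : Pintegrable f -> Pintegrable (fun t => `|f t|).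
Proof. by move=> /integrable_abse. Qed.

Lemma Pintegrable_mul_bounded f g (K : R) : Pintegrable f ->
  measurable_fun setT g -> (forall t, `|g t| <= K) ->
  Pintegrable (fun t => f t * g t).
Proof.
move=> fi mg gK.
apply: (@Pintegrable_le _ (fun t => K * `|f t|)); last first.
  exact/PintegrableZ/Pintegrable_norm.
  by move=> t; rewrite normrM mulrC ler_wpM2r.
by apply: measurable_funM => //; exact: Pintegrable_measurable.
Qed.

Lemma Rintegral_prob_cst (k : R) : \int[P]_t k = k.
Proof. by rewrite Rintegral_cst//= (probability_setT P) mulr1. Qed.

Lemma Rintegral_norm_le f g : Pintegrable f -> Pintegrable g ->
  (forall t, `|f t| <= g t) -> `|\int[P]_t f t| <= \int[P]_t g t.
Proof.
move=> fi gi fg; rewrite (le_trans (le_normr_Rintegral _ fi))//.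
by apply: le_Rintegral => //; exact: Pintegrable_norm.
Qed.

Lemma Rintegral_dominated_cvg (u : nat -> T -> R) f g :
  (forall n, measurable_fun setT (u n)) ->
  (forall t, u n t @[n --> \oo] --> f t) -> Pintegrable g ->
  (forall n t, `|u n t| <= g t) ->
  \int[P]_t u n t @[n --> \oo] --> \int[P]_t f t.
Proof.
move=> mu uf gi ug.
have mf : measurable_fun setT f.
  exact: (measurable_fun_cvg mu (fun t _ => uf t)).
have fg t : `|f t| <= g t.
  by apply: (ler_cvg_to (cvg_norm (uf t)) (cvg_cst (g t))); exact: nearW.
have fi := Pintegrable_le mf fg gi.
apply: fine_cvg; rewrite fineK; last exact: integrable_fin_num.
apply: (@dominated_cvg _ _ _ P setT measurableT (fun n t => (u n t)%:E) _ (EFin \o g)) => //.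
- by move=> n; exact/measurable_EFinP.
- by move=> t _; apply: cvg_EFin; [exact: nearW|exact: uf].
- by move=> n t _; rewrite lee_fin.
Qed.

End expectations.

Section conditional_expectation.
Context {d : measure_display} {T : measurableType d} {R : realType}.
Variable P : probability T R.

(* On functions with values in [0, 1] the defect [E (Z - g(X)) phi(X)] is halved
   when [phi] is replaced by [2 phi - 1_(phi >= 1/2)], hence it vanishes. *)
Lemma cond_exp_given_unit (X Z : T -> R) (g phi : R -> R) :
  measurable_fun setT X -> cond_exp_given P X Z g ->
  measurable_fun setT phi -> (forall x, 0 <= phi x <= 1) ->
  \int[P]_t ((Z t - g (X t)) * phi (X t)) = 0.
Proof.
move=> mX [mg Zi gi ZgE] mphi phi01.
pose D t := Z t - g (X t).
have Di : Pintegrable P D by exact: PintegrableB.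
have mcomp (psi : R -> R) : measurable_fun setT psi ->
  measurable_fun setT (fun t => psi (X t)) by move=> ?; exact: measurableT_comp.
have norm01 (psi : R -> R) : (forall x, 0 <= psi x <= 1) ->
    forall t, `|psi (X t)| <= 1.
  by move=> psi01 t; have /andP[? ?] := psi01 (X t); rewrite ger0_norm.
have indic01 (A : set R) x : 0 <= (\1_A x : R) <= 1.
  by rewrite indicE ler0n lern1 leq_b1.
have DpsiI (psi : R -> R) : measurable_fun setT psi -> (forall x, 0 <= psi x <= 1) ->
    Pintegrable P (fun t => D t * psi (X t)).
  move=> mpsi psi01.
  exact: (Pintegrable_mul_bounded Di (mcomp _ mpsi) (norm01 _ psi01)).
have D_indic (A : set R) : measurable A -> \int[P]_t (D t * \1_A (X t)) = 0.
  move=> mA.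
  have mXA : measurable (X @^-1` A) by rewrite -[X in measurable X]setTI; exact: mX.
  have -> : \int[P]_t (D t * \1_A (X t)) = \int[P]_(t in X @^-1` A) D t.
    rewrite [RHS]Rintegral_mkcond; apply: eq_Rintegral => t _; rewrite patchE indicE.
    have -> : (t \in X @^-1` A) = (X t \in A) by [].
    by case: (X t \in A); rewrite ?mulr1 ?mulr0.
  rewrite RintegralB//; [|exact: integrableS Zi|exact: integrableS gi].
  by rewrite /Rintegral ZgE// subrr.
pose C := \int[P]_t `|D t|.
suff H n : forall psi : R -> R, measurable_fun setT psi ->
    (forall x, 0 <= psi x <= 1) ->
    `|\int[P]_t (D t * psi (X t))| <= C / 2 ^+ n.
  apply/eqP; rewrite -normr_eq0 eq_le normr_ge0 andbT leNgt; apply/negP => L0.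
  have C0 : 0 <= C by exact: Rintegral_ge0.
  set L := `|_| in L0.
  have CL : 0 <= C / L by rewrite divr_ge0// ltW.
  (* As [C / L < n < 2 ^ n], the bound at this stage is already smaller than [L]. *)
  pose n := Num.Def.archi_bound (C / L).
  have := H n phi mphi phi01; rewrite -/D -/L; apply/negP; rewrite -ltNge.
  rewrite ltr_pdivrMr ?exprn_gt0// mulrC -ltr_pdivrMr//.
  rewrite (lt_trans (archi_boundP CL))// -natrX ltr_nat.
  exact: ltn_expl.
elim: n => [|n ih] psi mpsi psi01.
  rewrite expr0 divr1; apply: Rintegral_norm_le.
  - exact: DpsiI.
  - exact: Pintegrable_norm.
  - by move=> t; rewrite normrM ler_piMr// norm01.
(* [\1_A] is the leading binary digit of [psi] and [psi'] is the doubled rest; the digit integrates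
   to 0 against [D] by the defining property of the conditional expectation. *)
pose A := [set x | 2^-1 <= psi x].
have mA : measurable A.
  rewrite (_ : A = psi @^-1` `[2^-1, +oo[).
    by rewrite -[X in measurable X]setTI; apply: mpsi => //; exact: measurable_itv.
  by apply/seteqP; split => x /=; rewrite in_itv/= andbT.
pose psi' x := 2 * psi x - \1_A x.
have mpsi' : measurable_fun setT psi'.
  by apply: measurable_funB => //; exact: measurable_funM.
have psi'01 x : 0 <= psi' x <= 1.
  have /andP[p0 p1] := psi01 x; rewrite /psi' indicE.
  case: (boolP (x \in A)) => [|/negP]; rewrite inE /A/= => xA.
    by apply/andP; split; lra.
  by move/negP: xA; rewrite -ltNge => xA; apply/andP; split; lra.
have -> : \int[P]_t (D t * psi (X t)) = 2^-1 * \int[P]_t (D t * psi' (X t)).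
  have -> : \int[P]_t (D t * psi' (X t)) =
      \int[P]_t (2 * (D t * psi (X t)) - D t * \1_A (X t)).
    by apply: eq_Rintegral => t _; rewrite /psi'; ring.
  rewrite RintegralB//; [|exact/PintegrableZ/DpsiI|exact: DpsiI].
  rewrite D_indic// subr0 RintegralZl//; last exact: DpsiI.
  by rewrite mulKf.
rewrite normrM ger0_norm// exprS invfM mulrCA ler_wpM2l//.
exact: ih.
Qed.

End conditional_expectation.

Section conditional_expectation_bounded.
Context {d : measure_display} {T : measurableType d} {R : realType}.
Variable P : probability T R.

(** An affine change of scale brings [phi] into [[0, 1]]; the constant it introduces is handled by
    testing against the function 1. Taking [L = K + 1] keeps the divisor positive when [K = 0]. *)
Lemma cond_exp_given_bounded (X Z : T -> R) (g phi : R -> R) (K : R) :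
  measurable_fun setT X -> cond_exp_given P X Z g ->
  measurable_fun setT phi -> (forall x, `|phi x| <= K) ->
  \int[P]_t (Z t * phi (X t)) = \int[P]_t (g (X t) * phi (X t)).
Proof.
move=> mX cZ mphi phiK; have [mg Zi gi _] := cZ.
pose L := K + 1.
have K0 : 0 <= K by exact: le_trans (phiK 0).
have L0 : 0 < L by rewrite ltr_pwDr.
pose D t := Z t - g (X t).
have Di : Pintegrable P D by exact: PintegrableB.
have mphiX : measurable_fun setT (fun t => phi (X t)) by exact: measurableT_comp.
have bdI (F : T -> R) : Pintegrable P F ->
    Pintegrable P (fun t => F t * phi (X t)).
  by move=> Fi; apply: (Pintegrable_mul_bounded Fi mphiX) => t; exact: phiK.
apply/eqP; rewrite -subr_eq0 -RintegralB//; [|exact: bdI|exact: bdI].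
pose psi x := (phi x + L) / (2 * L).
have psi01 x : 0 <= psi x <= 1.
  have := phiK x; rewrite ler_norml => /andP[p1 p2]; rewrite /psi.
  rewrite divr_ge0/= ?ler_pdivrMr ?mulr_gt0//; rewrite /L; lra.
have mpsi : measurable_fun setT psi.
  by apply: measurable_funM => //; apply: measurable_funD.
have one01 (x : R) : 0 <= (1 : R) <= 1 by rewrite ler01 lexx.
have psi0 := cond_exp_given_unit mX cZ mpsi psi01.
have one0 := cond_exp_given_unit mX cZ (measurable_cst (1 : R)) one01.
have D0 : \int[P]_t D t = 0.
  by rewrite -one0; apply: eq_Rintegral => t _; rewrite mulr1.
have -> : \int[P]_t (Z t * phi (X t) - g (X t) * phi (X t)) =
    \int[P]_t (2 * L * (D t * psi (X t)) - L * D t).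
  apply: eq_Rintegral => t _; rewrite /psi /D; field.
  by rewrite gt_eqF.
have Dpsi : Pintegrable P (fun t => D t * psi (X t)).
  apply: (@Pintegrable_mul_bounded _ _ _ _ _ _ 1) => //.
    exact: measurableT_comp.
  by move=> t; have /andP[? ?] := psi01 (X t); rewrite ger0_norm.
rewrite RintegralB//; [|exact: PintegrableZ|exact: PintegrableZ].
by rewrite !RintegralZl// psi0 D0 !mulr0 subrr.
Qed.

End conditional_expectation_bounded.

(** * The exchangeable pair identity and the Stein decomposition *)

Section exchangeable_pairs.
Context {d : measure_display} {T : measurableType d} {R : realType}.
Variable P : probability T R.

(** Exchangeability says that [(X, Y)] and [(Y, X)] push [P] forward to the same measure. This
    settles nonnegative [F], and positive and negative parts settle the rest. *)
Lemma exchangeable_integral (X Y : {RV P >-> R}) (F : R * R -> \bar R) :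
  exchangeable P X Y -> measurable_fun setT F ->
  (\int[P]_t F (X t, Y t) = \int[P]_t F (Y t, X t))%E.
Proof.
move=> XY mF.
have mXY : measurable_fun setT (fun t => (X t, Y t)) by exact: measurable_fun_pair.
have mYX : measurable_fun setT (fun t => (Y t, X t)) by exact: measurable_fun_pair.
have ge0E (G : R * R -> \bar R) : measurable_fun setT G ->
    (forall x, (0 <= G x)%E) ->
    (\int[P]_t G (X t, Y t) = \int[P]_t G (Y t, X t))%E.
  move=> mG G0.
  have := @ge0_integral_pushforward _ _ _ _ _ _ mXY P setT G measurableT mG (fun x _ => G0 x).
  have := @ge0_integral_pushforward _ _ _ _ _ _ mYX P setT G measurableT mG (fun x _ => G0 x).
  rewrite !preimage_setT /comp => <- <-.
  apply: eq_measure_integral => A mA _.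
  exact: XY.
rewrite integralE [RHS]integralE; congr (_ - _)%E.
  have := ge0E F^\+%E (measurable_funepos mF) (fun x => funepos_ge0 F x).
  by rewrite unlock.
have := ge0E F^\-%E (measurable_funeneg mF) (fun x => funeneg_ge0 F x).
by rewrite unlock.
Qed.

Lemma exchangeable_Rintegral (X Y : {RV P >-> R}) (F : R * R -> R) :
  exchangeable P X Y -> measurable_fun setT F ->
  \int[P]_t F (X t, Y t) = \int[P]_t F (Y t, X t).
Proof.
move=> XY mF; rewrite /Rintegral.
by rewrite (exchangeable_integral XY (F := EFin \o F))//; exact/measurable_EFinP.
Qed.

End exchangeable_pairs.

Section exchangeable_pair_identity.
Context {d : measure_display} {T : measurableType d} {R : realType}.
Variables (P : probability T R) (W W' : {RV P >-> R}) (c0 : R) (r : R -> R).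
Hypothesis WW' : exchangeable P W W'.
Hypothesis c0_gt0 : 0 < c0.
Hypothesis Wr :
  cond_exp_given P W (fun t => W t - W' t) (fun w => c0^-1 + r w).

Let D t := W t - W' t.

Lemma drift_integrable : Pintegrable P (fun t => r (W t)).
Proof.
have [_ _ cri _] := Wr.
have : Pintegrable P (fun t => (c0^-1 + r (W t)) - c0^-1).
  exact: (PintegrableB cri (Pintegrable_cst P c0^-1)).
by apply: eq_integrable => // t _ /=; rewrite addrC addKr.
Qed.

Lemma measurable_comp_W (f : R -> R) : measurable_fun setT f ->
  measurable_fun setT (fun t => f (W t)).
Proof. by move=> mf; exact: measurableT_comp. Qed.

Lemma measurable_comp_W' (f : R -> R) : measurable_fun setT f ->
  measurable_fun setT (fun t => f (W' t)).
Proof. by move=> mf; exact: measurableT_comp. Qed.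

(** Swapping [W] and [W'] reverses the sign of [D], so [E D f(W') = - E D f(W)] and
    [E D (f(W) - f(W')) = 2 E D f(W)]. The regression condition, tested against the bounded [f],
    evaluates [E D f(W)]. *)
Lemma exchangeable_pair_identity_bounded (f : R -> R) (K : R) :
  measurable_fun setT f -> (forall x, `|f x| <= K) ->
  \int[P]_t f (W t) = c0 / 2 * \int[P]_t (D t * (f (W t) - f (W' t)))
                      - c0 * \int[P]_t (f (W t) * r (W t)).
Proof.
move=> mf fK.
have mfW := measurable_comp_W mf; have mfW' := measurable_comp_W' mf.
have [_ Di cri _] := Wr.
have fi : Pintegrable P (fun t => f (W t)).
  by apply: (Pintegrable_bounded P mfW) => t; exact: fK.
have rfi : Pintegrable P (fun t => r (W t) * f (W t)).
  by apply: (Pintegrable_mul_bounded drift_integrable mfW) => t; exact: fK.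
have DfW : Pintegrable P (fun t => D t * f (W t)).
  by apply: (Pintegrable_mul_bounded Di mfW) => t; exact: fK.
have DfW' : Pintegrable P (fun t => D t * f (W' t)).
  by apply: (Pintegrable_mul_bounded Di mfW') => t; exact: fK.
have E1 : \int[P]_t (D t * f (W t)) =
    c0^-1 * \int[P]_t f (W t) + \int[P]_t (r (W t) * f (W t)).
  have mW : measurable_fun setT W by [].
  rewrite (cond_exp_given_bounded mW Wr mf fK).
  rewrite -RintegralZl// -RintegralD//; last exact: PintegrableZ.
  by apply: eq_Rintegral => t _; rewrite mulrDl.
have E2 : \int[P]_t (D t * f (W' t)) = - \int[P]_t (D t * f (W t)).
  have := exchangeable_Rintegral WW' (F := fun x => (x.1 - x.2) * f x.2).
  move=> /= -> ; last first.
    apply: measurable_funM; first exact: measurable_funB.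
    by apply: (measurableT_comp mf).
  rewrite -[RHS]mulN1r -RintegralZl//; apply: eq_Rintegral => t _.
  by rewrite /D; ring.
have -> : \int[P]_t (f (W t) * r (W t)) = \int[P]_t (r (W t) * f (W t)).
  by apply: eq_Rintegral => t _; rewrite mulrC.
have -> : \int[P]_t (D t * (f (W t) - f (W' t))) =
    \int[P]_t (D t * f (W t)) - \int[P]_t (D t * f (W' t)).
  by rewrite -RintegralB//; apply: eq_Rintegral => t _; rewrite mulrBr.
rewrite E2 E1; field; exact: lt0r_neq0.
Qed.

End exchangeable_pair_identity.

Section lipschitz_identity.
Context {d : measure_display} {T : measurableType d} {R : realType}.
Variables (P : probability T R) (W W' : {RV P >-> R}) (c0 : R) (r g2 : R -> R).
Hypothesis WW' : exchangeable P W W'.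
Hypothesis c0_gt0 : 0 < c0.
Hypothesis Wr :
  cond_exp_given P W (fun t => W t - W' t) (fun w => c0^-1 + r w).
Hypothesis Wg2 : cond_exp_given P W (fun t => (W t - W' t) ^+ 2) g2.
Hypothesis Wri : Pintegrable P (fun t => W t * r (W t)).

Let D t := W t - W' t.

Lemma lipschitz_measurable (f : R -> R) (L : R) :
  (forall x y, `|f x - f y| <= L * `|x - y|) -> measurable_fun setT f.
Proof.
move=> fL; apply: continuous_measurable_fun => x.
have L0 : 0 <= L.
  by have := le_trans (normr_ge0 _) (fL 1 0); rewrite subr0 normr1 mulr1.
apply/cvgrPdist_lt => e e0; near=> y.
rewrite (le_lt_trans (fL _ _))// (@le_lt_trans _ _ ((L + 1) * `|x - y|))//.
  by rewrite ler_wpM2r// lerDl.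
rewrite mulrC -ltr_pdivlMr ?ltr_wpDl//.
by near: y; apply: cvgr_dist_lt => //; rewrite divr_gt0// ltr_wpDl.
Unshelve. all: by end_near. Qed.

Let D2i : Pintegrable P (fun t => D t ^+ 2).
Proof. by have [] := Wg2. Qed.

Let mD : measurable_fun setT D.
Proof. exact: measurable_funB. Qed.

Lemma lipschitz_increment_integrable (f : R -> R) (L : R) :
  (forall x y, `|f x - f y| <= L * `|x - y|) ->
  Pintegrable P (fun t => D t * (f (W t) - f (W' t))).
Proof.
move=> fL; have mf := lipschitz_measurable fL.
apply: Pintegrable_le (PintegrableZ L D2i).
  apply: measurable_funM => //.
  by apply: measurable_funB; [exact: measurable_comp_W|exact: measurable_comp_W'].
move=> t; rewrite normrM (le_trans (ler_wpM2l (normr_ge0 _) (fL _ _)))//.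
by rewrite -/(D t) mulrCA -expr2 real_normK ?num_real.
Qed.

Let trunc_abs (n : nat) (x : R) : R := Num.min `|x| n%:R.

Let trunc_abs_ge0 n x : 0 <= trunc_abs n x.
Proof. by rewrite /trunc_abs le_min normr_ge0 ler0n. Qed.

Let trunc_abs_le n x : trunc_abs n x <= `|x|.
Proof. by rewrite /trunc_abs ge_min lexx. Qed.

Let trunc_abs_lip n x y : `|trunc_abs n x - trunc_abs n y| <= `|x - y|.
Proof.
apply: le_trans (ler_dist_dist x y).
rewrite /trunc_abs; move: `|x| `|y| => {x y} x y.
rewrite ler_norml; case: (leP x n%:R) => ?; case: (leP y n%:R) => ?;
  case: (ler0P (x - y)) => ?; apply/andP; split; lra.
Qed.

(** The function [min(|w|, n)] is bounded, 1-Lipschitz and at most [|w|], so the bounded identity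
    gives [E min(|W|, n) <= K] with [K] independent of [n]; monotone convergence concludes. *)
Lemma exchangeable_pair_integrable : Pintegrable P W.
Proof.
have mW : measurable_fun setT W by [].
pose K := c0 / 2 * \int[P]_t (D t ^+ 2) + c0 * \int[P]_t `|W t * r (W t)|.
have lip1 n x y : `|trunc_abs n x - trunc_abs n y| <= 1 * `|x - y|.
  by rewrite mul1r.
have mtr n : measurable_fun setT (trunc_abs n) by exact: lipschitz_measurable (lip1 n).
have trn n x : `|trunc_abs n x| <= n%:R.
  by rewrite ger0_norm// /trunc_abs ge_min lexx orbT.
have bound n : \int[P]_t trunc_abs n (W t) <= K.
  rewrite (exchangeable_pair_identity_bounded WW' c0_gt0 Wr (mtr n) (trn n)).
  rewrite /K lerD//.
    rewrite ler_pM2l ?divr_gt0//; apply: le_Rintegral => //.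
      exact: lipschitz_increment_integrable (lip1 n).
    move=> t _; rewrite (le_trans (ler_norm _))// normrM.
    rewrite (le_trans (ler_wpM2l (normr_ge0 _) (trunc_abs_lip n _ _)))//.
    by rewrite -/(D t) -expr2 real_normK ?num_real.
  rewrite -mulrN ler_pM2l// (le_trans (ler_norm _))// normrN.
  apply: Rintegral_norm_le.
  - have : Pintegrable P (fun t => r (W t) * trunc_abs n (W t)).
      apply: (Pintegrable_mul_bounded (drift_integrable Wr)) => [|t].
        exact: measurable_comp_W (mtr n).
      exact: trn.
    by apply: eq_integrable => // t _ /=; rewrite mulrC.
  - exact: Pintegrable_norm.
  - by move=> t; rewrite !normrM ler_wpM2r// ger0_norm.
apply/integrableP; split; first exact/measurable_EFinP.
apply: (@le_lt_trans _ _ K%:E); last exact: ltry.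
have trc x : trunc_abs n x @[n --> \oo] --> `|x|.
  apply: cvg_near_cst; near=> n; apply/eqP; rewrite /trunc_abs min_l//.
  by near: n; exact: nbhs_infty_ger.
have := @cvg_monotone_convergence _ _ _ P setT measurableT
  (fun n t => (trunc_abs n (W t))%:E).
have -> : (fun t => limn (fun n => (trunc_abs n (W t))%:E)) =
    (fun t => `|(W t)%:E|)%E.
  apply/funext => t; apply: cvg_lim => //.
  by apply: cvg_EFin; [exact: nearW|exact: trc].
move=> /(_ _ _ _)/cvg_lim <- //.
- apply: lime_le; last first.
    apply: nearW => n.
    rewrite -[leLHS]fineK; first by rewrite lee_fin; exact: bound.
    apply: integrable_fin_num => //.
    apply: (Pintegrable_bounded P (K := n%:R)); first exact: measurable_comp_W (mtr n).
    by move=> t; exact: trn.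
  apply: ereal_nondecreasing_is_cvgn => m n mn; apply: ge0_le_integral => //.
  + by move=> t _; rewrite lee_fin.
  + by apply/measurable_EFinP; exact: measurable_comp_W (mtr m).
  + by apply/measurable_EFinP; exact: measurable_comp_W (mtr n).
  + move=> t _; rewrite lee_fin /trunc_abs le_min ge_min lexx/= ge_min.
    by rewrite ler_nat mn orbT.
- by move=> n; apply/measurable_EFinP; exact: measurable_comp_W (mtr n).
- by move=> n t _; rewrite lee_fin.
- move=> t _ m n mn; rewrite lee_fin /trunc_abs le_min ge_min lexx/= ge_min.
  by rewrite ler_nat mn orbT.
Unshelve. all: by end_near. Qed.

End lipschitz_identity.

Section stein_decomposition.
Context {d : measure_display} {T : measurableType d} {R : realType}.
Variables (P : probability T R) (W W' : {RV P >-> R}) (c0 : R) (r g2 : R -> R).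
Hypothesis WW' : exchangeable P W W'.
Hypothesis c0_gt0 : 0 < c0.
Hypothesis Wr :
  cond_exp_given P W (fun t => W t - W' t) (fun w => c0^-1 + r w).
Hypothesis Wg2 : cond_exp_given P W (fun t => (W t - W' t) ^+ 2) g2.
Hypothesis Wri : Pintegrable P (fun t => W t * r (W t)).

Let D t := W t - W' t.

Let Wi : Pintegrable P W.
Proof. exact: (exchangeable_pair_integrable WW' c0_gt0 Wr Wg2 Wri). Qed.

Lemma lipschitz_integrable (f : R -> R) (L : R) :
  (forall x y, `|f x - f y| <= L * `|x - y|) ->
  Pintegrable P (fun t => f (W t)).
Proof.
move=> fL; have mf := lipschitz_measurable fL.
apply: (@Pintegrable_le _ _ _ _ _ (fun t => `|f 0| + L * `|W t|)).
- exact: measurable_comp_W.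
- move=> t; have := fL (W t) 0; rewrite subr0 -lerBlDl; apply: le_trans.
  exact: lerB_dist.
- apply: PintegrableD; first exact: Pintegrable_cst.
  exact/PintegrableZ/Pintegrable_norm.
Qed.

Lemma linear_growth_drift_integrable (f : R -> R) (L : R) :
  measurable_fun setT f -> (forall x, `|f x| <= L * `|x|) ->
  Pintegrable P (fun t => f (W t) * r (W t)).
Proof.
move=> mf fL.
apply: Pintegrable_le (PintegrableZ L (Pintegrable_norm Wri)).
  apply: measurable_funM; first exact: measurable_comp_W.
  exact/Pintegrable_measurable/(drift_integrable Wr).
by move=> t; rewrite !normrM mulrA ler_wpM2r.
Qed.

(** Limit of the bounded identity for [f] composed with the clamp to [[-n, n]], which keeps both the
    Lipschitz constant and the value at 0. The dominating functions are [L |W|], [L D^2] and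
    [L |W r(W)|]; the first is integrable by [exchangeable_pair_integrable]. *)
Lemma exchangeable_pair_identity (f : R -> R) (L : R) : f 0 = 0 ->
  (forall x y, `|f x - f y| <= L * `|x - y|) ->
  \int[P]_t f (W t) = c0 / 2 * \int[P]_t (D t * (f (W t) - f (W' t)))
                      - c0 * \int[P]_t (f (W t) * r (W t)).
Proof.
move=> f0 fL; have mf := lipschitz_measurable fL.
have L0 : 0 <= L.
  by have := le_trans (normr_ge0 _) (fL 1 0); rewrite subr0 normr1 mulr1.
pose cn (n : nat) x : R := clamp (- n%:R) n%:R x.
pose u n x := f (cn n x).
have cn0 n : cn n 0 = 0 by rewrite /cn clamp_id// oppr_le0.
have uL n x y : `|u n x - u n y| <= L * `|x - y|.
  by rewrite (le_trans (fL _ _))// ler_wpM2l// clamp_lip.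
have mu n : measurable_fun setT (u n) by exact: lipschitz_measurable (uL n).
have ug n x : `|u n x| <= L * `|x|.
  by have := uL n x 0; rewrite /u cn0 f0 !subr0.
have ub n x : `|u n x| <= L * n%:R.
  have := fL (cn n x) 0; rewrite f0 !subr0 => /le_trans; apply.
  rewrite ler_wpM2l// ler_norml clamp_ge clamp_le//.
  by rewrite (@le_trans _ _ 0)// oppr_le0.
have uc x : u n x @[n --> \oo] --> f x.
  apply: cvg_near_cst; near=> n; apply/eqP; rewrite /u /cn.
  have : `|x| <= n%:R by near: n; exact: nbhs_infty_ger.
  by rewrite ler_norml => /andP[? ?]; rewrite clamp_id.
have E n := exchangeable_pair_identity_bounded WW' c0_gt0 Wr (mu n) (ub n).
have c1 : \int[P]_t u n (W t) @[n --> \oo] --> \int[P]_t f (W t).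
  apply: (@Rintegral_dominated_cvg _ _ _ _ _ _ (fun t => L * `|W t|)) => //.
  - by move=> n; exact: measurable_comp_W.
  - exact/PintegrableZ/Pintegrable_norm.
have c2 : \int[P]_t (D t * (u n (W t) - u n (W' t))) @[n --> \oo] -->
    \int[P]_t (D t * (f (W t) - f (W' t))).
  apply: (@Rintegral_dominated_cvg _ _ _ _ _ _ (fun t => L * D t ^+ 2)).
  - move=> n; apply: measurable_funM; first exact: measurable_funB.
    by apply: measurable_funB; [exact: measurable_comp_W|exact: measurable_comp_W'].
  - by move=> t; apply: cvgMr; apply: cvgB.
  - by apply: PintegrableZ; have [] := Wg2.
  - move=> n t; rewrite normrM (le_trans (ler_wpM2l (normr_ge0 _) (uL _ _ _)))//.
    by rewrite -/(D t) mulrCA -expr2 real_normK ?num_real.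
have c3 : \int[P]_t (u n (W t) * r (W t)) @[n --> \oo] -->
    \int[P]_t (f (W t) * r (W t)).
  apply: (@Rintegral_dominated_cvg _ _ _ _ _ _ (fun t => L * `|W t * r (W t)|)).
  - move=> n; apply: Pintegrable_measurable.
    exact: linear_growth_drift_integrable (ug n).
  - by move=> t; apply: cvgMl; exact: uc.
  - exact/PintegrableZ/Pintegrable_norm.
  - by move=> n t; rewrite !normrM mulrA ler_wpM2r.
have c4 : c0 / 2 * \int[P]_t (D t * (u n (W t) - u n (W' t)))
    - c0 * \int[P]_t (u n (W t) * r (W t)) @[n --> \oo] -->
    c0 / 2 * \int[P]_t (D t * (f (W t) - f (W' t)))
    - c0 * \int[P]_t (f (W t) * r (W t)).
  by apply: cvgB; apply: cvgMr.
rewrite -(cvg_lim _ c1)// -(cvg_lim _ c4)//; congr (limn _).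
by apply/funext => n; rewrite E.
Unshelve. all: by end_near. Qed.

(** Here [phi] is not tied to [f]: [E D^2 phi(W)] is added and subtracted, once in the form
    [E g2(W) phi(W)]. Choosing for [phi] a derivative of [f] turns the second integral into a Taylor
    remainder, while a kink of [f] is allowed. *)
Lemma stein_decomposition (f phi : R -> R) (L K : R) : f 0 = 0 ->
  (forall x y, `|f x - f y| <= L * `|x - y|) ->
  measurable_fun setT phi -> (forall x, `|phi x| <= K) ->
  \int[P]_t (phi (W t) - f (W t)) =
  \int[P]_t (phi (W t) * (1 - c0 / 2 * g2 (W t)))
  + c0 / 2 * \int[P]_t (D t ^+ 2 * phi (W t) - D t * (f (W t) - f (W' t)))
  + c0 * \int[P]_t (f (W t) * r (W t)).
Proof.
move=> f0 fL mphi phiK.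
have [mg2 D2i g2i _] := Wg2.
have mphiW : measurable_fun setT (fun t => phi (W t)) by exact: measurable_comp_W.
have phii : Pintegrable P (fun t => phi (W t)).
  by apply: (Pintegrable_bounded P mphiW) => t; exact: phiK.
have g2phi : Pintegrable P (fun t => g2 (W t) * phi (W t)).
  by apply: (Pintegrable_mul_bounded g2i mphiW) => t; exact: phiK.
have D2phi : Pintegrable P (fun t => D t ^+ 2 * phi (W t)).
  by apply: (Pintegrable_mul_bounded D2i mphiW) => t; exact: phiK.
have mW : measurable_fun setT W by [].
rewrite RintegralB//; last exact: lipschitz_integrable fL.
rewrite [X in _ + c0 / 2 * X]RintegralB//; last first.
  exact: (lipschitz_increment_integrable Wg2 fL).
rewrite (exchangeable_pair_identity f0 fL) (cond_exp_given_bounded mW Wg2 mphi phiK).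
have -> : \int[P]_t (phi (W t) * (1 - c0 / 2 * g2 (W t))) =
    \int[P]_t phi (W t) - c0 / 2 * \int[P]_t (g2 (W t) * phi (W t)).
  rewrite -RintegralZl// -RintegralB//; last exact: PintegrableZ.
  by apply: eq_Rintegral => t _; ring.
by rewrite /D; ring.
Qed.

End stein_decomposition.

(** * The Stein solution for the indicator of a half-line *)

Section truncated_exponential.
Context {R : realType}.
Implicit Types x y z u v w : R.

Definition below z w : R := (w <= z)%R%:R.

(** The value at [w = 0] is the exponential tail [P(Y > z)], for [z] of either sign. Hence
    [f = trunc_exp z - trunc_exp z 0] satisfies [f' - f = below z - P(Y <= z)], with [trunc_exp' z]
    in the role of [f']. *)
Definition trunc_exp z w : R := expR (Num.min (w - z) 0).

(* the left derivative of [trunc_exp z] *)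
Definition trunc_exp' z w : R := trunc_exp z w - 1 + below z w.

Definition crossing z w w' : R := below z w * (1 - below z w').

Lemma below_ge0 z w : 0 <= below z w. Proof. by rewrite ler0n. Qed.

Lemma below_le1 z w : below z w <= 1.
Proof. by rewrite /below lern1 leq_b1. Qed.

Lemma measurable_below z : measurable_fun setT (below z).
Proof.
rewrite (_ : below z = \1_`]-oo, z]%classic).
  by apply: measurable_indic; exact: measurable_itv.
apply/funext => w; rewrite indicE /below; congr (_%:R); congr nat_of_bool.
by apply/idP/idP; rewrite inE/= in_itv.
Qed.

Lemma trunc_exp_gt z w : z < w -> trunc_exp z w = 1.
Proof. by move=> zw; rewrite /trunc_exp min_r ?expR0// subr_ge0 ltW. Qed.

Lemma trunc_exp_le z w : w <= z -> trunc_exp z w = expR (w - z).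
Proof. by move=> wz; rewrite /trunc_exp min_l// subr_le0. Qed.

Lemma trunc_exp_ge0 z w : 0 <= trunc_exp z w. Proof. exact: expR_ge0. Qed.

Lemma trunc_exp_le1 z w : trunc_exp z w <= 1.
Proof. by rewrite /trunc_exp -expR0 ler_expR ge_min lexx orbT. Qed.

(** With [u <= v], factor [e^v <= 1] out of the difference and apply [1 + x <= e^x] at
    [x = u - v]. *)
Lemma expR_le0_lipschitz u v : u <= 0 -> v <= 0 -> `|expR u - expR v| <= `|u - v|.
Proof.
wlog uv : u v / u <= v => [H u0 v0|u0 v0].
  have [/H|/ltW/H] := leP u v; first exact.
  by rewrite distrC (distrC u); exact.
rewrite distrC (distrC u) !ger0_norm ?subr_ge0 ?ler_expR//.
have e1 : expR v <= 1 by rewrite -expR0 ler_expR.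
have e0 := expR_gt0 v.
have := expR_ge1Dx (u - v).
have -> : expR u = expR v * expR (u - v) by rewrite -expRD subrKC.
nra.
Qed.

Lemma trunc_exp_lipschitz z x y : `|trunc_exp z x - trunc_exp z y| <= `|x - y|.
Proof.
apply: le_trans (expR_le0_lipschitz _ _) _; rewrite ?ge_min ?lexx ?orbT//.
rewrite -[leRHS](_ : `|(x - z) - (y - z)| = _); last by congr `|_|; ring.
move: (x - z) (y - z) => {z}a b.
rewrite ler_norml; case: (leP a 0) => ?; case: (leP b 0) => ?;
  case: (ler0P (a - b)) => ?; apply/andP; split; lra.
Qed.

Lemma trunc_exp'_ge0 z w : 0 <= trunc_exp' z w.
Proof.
rewrite /trunc_exp' /below; case: (leP w z) => wz /=.
  by rewrite subrK trunc_exp_ge0.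
by rewrite trunc_exp_gt// subrr addr0.
Qed.

Lemma trunc_exp'_le1 z w : trunc_exp' z w <= 1.
Proof.
rewrite /trunc_exp'; have := trunc_exp_le1 z w; have := below_le1 z w; lra.
Qed.

Lemma measurable_trunc_exp' z : measurable_fun setT (trunc_exp' z).
Proof.
apply: measurable_funD; last exact: measurable_below.
apply: measurable_funB => //; apply: (@lipschitz_measurable _ _ 1) => x y.
by rewrite mul1r trunc_exp_lipschitz.
Qed.

(** The tangent line at [u] gives the sign. The tangent line at [v] bounds the remainder by
    [(u - v) (e^u - e^v)], and the Lipschitz estimate finishes. *)
Lemma expR_remainder u v : u <= 0 -> v <= 0 ->
  0 <= (u - v) * expR u - (expR u - expR v) <= (u - v) ^+ 2.
Proof.
move=> u0 v0.
have h1 : expR u * (1 + (v - u)) <= expR v.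
  have -> : expR v = expR u * expR (v - u) by rewrite -expRD subrKC.
  by rewrite ler_pM2l ?expR_gt0// expR_ge1Dx.
have h2 : expR v * (1 + (u - v)) <= expR u.
  have -> : expR u = expR v * expR (u - v) by rewrite -expRD subrKC.
  by rewrite ler_pM2l ?expR_gt0// expR_ge1Dx.
have h3 : (u - v) * (expR u - expR v) <= (u - v) ^+ 2.
  rewrite (le_trans (ler_norm _))// normrM.
  rewrite (le_trans (ler_wpM2l (normr_ge0 _) (expR_le0_lipschitz u0 v0)))//.
  by rewrite -expr2 real_normK ?num_real.
by apply/andP; split; lra.
Qed.

(** Away from the kink the remainder is cubic by [expR_remainder]. Only a passage [w <= z < w']
    costs a term [D^2] here, and only the opposite passage does so in the lower estimate; bounding
    the absolute value at once would charge both. *)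
Lemma trunc_exp_taylor_upper z w w' :
  (w - w') ^+ 2 * trunc_exp' z w - (w - w') * (trunc_exp z w - trunc_exp z w')
  <= `|w - w'| ^+ 3 + (w - w') ^+ 2 * crossing z w w'.
Proof.
have N0 : 0 <= `|w - w'| ^+ 3 by rewrite exprn_ge0.
rewrite /trunc_exp' /crossing /below.
case: (leP w z) => wz; case: (leP w' z) => w'z /=;
  rewrite ?(trunc_exp_le wz) ?(trunc_exp_le w'z) ?(trunc_exp_gt wz) ?(trunc_exp_gt w'z).
- have u0 : w - z <= 0 by lra.
  have v0 : w' - z <= 0 by lra.
  have := expR_remainder u0 v0.
  have -> : w - z - (w' - z) = w - w' by ring.
  set q := _ - _ => /andP[q0 qD].
  rewrite [leLHS](_ : _ = (w - w') * q); last by rewrite /q; ring.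
  rewrite subrr !mulr0 addr0 (le_trans (ler_norm _))// normrM exprS.
  by rewrite ler_wpM2l// ger0_norm// real_normK ?num_real.
- have e1 : expR (w - z) <= 1 by rewrite -expR0 ler_expR; lra.
  have e0 := expR_gt0 (w - z).
  have : 0 <= (w - w') * (expR (w - z) - 1) by nra.
  nra.
- have e1 : expR (w' - z) <= 1 by rewrite -expR0 ler_expR; lra.
  nra.
- by rewrite !subrr; lra.
Qed.

Lemma trunc_exp_taylor_lower z w w' :
  - ((w - w') ^+ 2 * trunc_exp' z w
     - (w - w') * (trunc_exp z w - trunc_exp z w'))
  <= `|w - w'| ^+ 3 + (w - w') ^+ 2 * crossing z w' w.
Proof.
have N0 : 0 <= `|w - w'| ^+ 3 by rewrite exprn_ge0.
rewrite /trunc_exp' /crossing /below.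
case: (leP w z) => wz; case: (leP w' z) => w'z /=;
  rewrite ?(trunc_exp_le wz) ?(trunc_exp_le w'z) ?(trunc_exp_gt wz) ?(trunc_exp_gt w'z).
- have u0 : w - z <= 0 by lra.
  have v0 : w' - z <= 0 by lra.
  have := expR_remainder u0 v0.
  have -> : w - z - (w' - z) = w - w' by ring.
  set q := _ - _ => /andP[q0 qD].
  rewrite [leLHS](_ : _ = - ((w - w') * q)); last by rewrite /q; ring.
  rewrite subrr !mulr0 addr0 (le_trans (ler_norm _))// normrN normrM exprS.
  by rewrite ler_wpM2l// ger0_norm// real_normK ?num_real.
(* In this case [w <= z < w'] and the crossing term vanishes, so the cubic term alone must suffice.
   The bound [1 - e^(-x) (1 + x) <= x^2] at [x = z - w] persists when the factor [1 + x] and the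
   right side are taken at the larger [k = w' - w]. *)
- rewrite ltr0_norm; last lra.
  set x := z - w; have x0 : 0 <= x by rewrite /x; lra.
  have -> : w - z = - x by rewrite /x; ring.
  have e1 := expR_ge1Dx (- x); have e0 := expR_gt0 (- x).
  have h : 1 - expR (- x) * (1 + x) <= x ^+ 2 by nra.
  set k := w' - w; have kx : x < k by rewrite /k /x; lra.
  have -> : w - w' = - k by rewrite /k; ring.
  have k2 : 1 - expR (- x) * (1 + k) <= k ^+ 2 by nra.
  have : k * (1 - expR (- x) * (1 + k)) <= k * k ^+ 2.
    by rewrite ler_pM2l//; lra.
  lra.
- have e1 := expR_ge1Dx (w' - z).
  nra.
- by rewrite !subrr; lra.
Qed.

End truncated_exponential.

(** * Concentration near [z] and the Kolmogorov bound *)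

Section kolmogorov_bound.
Context {d : measure_display} {T : measurableType d} {R : realType}.
Variables (P : probability T R) (W W' : {RV P >-> R}) (c0 : R) (r g2 : R -> R).
Hypothesis WW' : exchangeable P W W'.
Hypothesis c0_gt0 : 0 < c0.
Hypothesis Wr :
  cond_exp_given P W (fun t => W t - W' t) (fun w => c0^-1 + r w).
Hypothesis Wg2 : cond_exp_given P W (fun t => (W t - W' t) ^+ 2) g2.
Hypothesis Wri : Pintegrable P (fun t => W t * r (W t)).
Variable delta : R.
Hypothesis Ddelta : forall t, `|W t - W' t| <= delta.

Let D t := W t - W' t.

Let D2i : Pintegrable P (fun t => D t ^+ 2).
Proof. by have [] := Wg2. Qed.

Lemma measurable_crossing z :
  measurable_fun setT (fun x : R * R => crossing z x.1 x.2).
Proof.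
apply: measurable_funM.
  by apply: (measurableT_comp (measurable_below z)).
by apply: measurable_funB => //; apply: (measurableT_comp (measurable_below z)).
Qed.

Lemma crossing_ge0 z w w' : 0 <= crossing z w w' :> R.
Proof. by rewrite mulr_ge0 ?below_ge0// subr_ge0 below_le1. Qed.

Lemma crossing_le1 z w w' : crossing z w w' <= 1 :> R.
Proof.
by rewrite mulr_ile1 ?below_ge0 ?below_le1 ?subr_ge0 ?below_le1// lerBlDr lerDl below_ge0.
Qed.

Lemma crossing_norm z w w' : `|crossing z w w'| <= 1 :> R.
Proof. by rewrite ger0_norm ?crossing_le1// crossing_ge0. Qed.

(** If [w] and [w'] lie on opposite sides of [z], one crossing equals 1 and both points are in the
    window, where the clamp is the identity. Otherwise the left side is 0, and the right side is
    nonnegative by monotonicity. *)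
Lemma crossing_le_clamp z w w' : `|w - w'| <= delta ->
  (w - w') ^+ 2 * crossing z w w' + (w - w') ^+ 2 * crossing z w' w <=
  (w - w') * (clamp (z - delta) (z + delta) w - clamp (z - delta) (z + delta) w').
Proof.
move=> wd.
have pos : 0 <= (w - w') * (clamp (z - delta) (z + delta) w
    - clamp (z - delta) (z + delta) w').
  have [ww'|/ltW ww'] := leP w w'.
    by rewrite mulr_le0// subr_le0 ?clamp_homo.
  by rewrite mulr_ge0// subr_ge0 ?clamp_homo.
move: wd; rewrite ler_norml => /andP[d1 d2].
rewrite /crossing /below.
case: (leP w z) => wz; case: (leP w' z) => w'z /=.
- by rewrite subrr !mulr0 addr0.
- rewrite subr0 !mul0r mulr0 addr0 !mulr1 expr2.
  by rewrite !clamp_id//; lra.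
- rewrite subr0 !mul0r mulr0 add0r !mulr1 expr2.
  by rewrite !clamp_id//; lra.
- by rewrite !mul0r !mulr0 addr0.
Qed.

Let crossingi z : Pintegrable P (fun t => D t ^+ 2 * crossing z (W t) (W' t)).
Proof.
apply: (Pintegrable_mul_bounded D2i) => [|t]; last exact: crossing_norm.
have mp : measurable_fun setT (fun t => (W t, W' t)) by exact: measurable_fun_pair.
exact: (measurableT_comp (measurable_crossing z) mp).
Qed.

Let crossing'i z : Pintegrable P (fun t => D t ^+ 2 * crossing z (W' t) (W t)).
Proof.
apply: (Pintegrable_mul_bounded D2i) => [|t]; last exact: crossing_norm.
have mp : measurable_fun setT (fun t => (W' t, W t)) by exact: measurable_fun_pair.
exact: (measurableT_comp (measurable_crossing z) mp).
Qed.

(** [D^2] is symmetric, so exchanging [W] and [W'] turns upward crossings of [z] into downward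
    ones. *)
Lemma crossing_exchange z :
  \int[P]_t (D t ^+ 2 * crossing z (W' t) (W t)) =
  \int[P]_t (D t ^+ 2 * crossing z (W t) (W' t)).
Proof.
have := exchangeable_Rintegral WW'
  (F := fun x => (x.1 - x.2) ^+ 2 * crossing z x.1 x.2).
move=> /= ->; last first.
  apply: measurable_funM; last exact: measurable_crossing.
  by apply: measurable_funX; exact: measurable_funB.
by apply: eq_Rintegral => t _; rewrite /D -sqrrN opprB.
Qed.

(** A space of total mass 1 has a point, and the bound on [|W - W'|] there gives the sign. *)
Lemma delta_ge0 : 0 <= delta.
Proof.
have [t _] : exists t : T, True.
  have : P setT != 0%E by rewrite (probability_setT P) onee_neq0.
  by move=> /eqP PT; apply: contrapT => /forallNP T0; apply: PT;
    rewrite (_ : setT = set0) ?measure0//; apply/seteqP; split => // t _; exact: (T0 t).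
exact: le_trans (Ddelta t).
Qed.

(* The clamp to [z - delta, z + delta] is constant off the window and increases
   by at most 2 delta, while every crossing of z happens inside the window. *)
Lemma crossing_concentration z :
  \int[P]_t (D t ^+ 2 * crossing z (W t) (W' t)) <=
  2 * delta / c0 + \int[P]_t `|W t * r (W t)|.
Proof.
have d0 := delta_ge0.
pose cl := clamp (z - delta) (z + delta).
pose f x := cl x - cl 0.
have f0 : f 0 = 0 by rewrite /f subrr.
have fL x y : `|f x - f y| <= 1 * `|x - y|.
  by rewrite mul1r /f opprB addrA subrK; exact: clamp_lip.
have fg x : `|f x| <= 1 * `|x| by have := fL x 0; rewrite f0 !subr0.
have mf := lipschitz_measurable fL.
have fi : Pintegrable P (fun t => f (W t)).
  exact: (lipschitz_integrable WW' c0_gt0 Wr Wg2 Wri fL).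
have fri := linear_growth_drift_integrable Wr Wri mf fg.
have E := exchangeable_pair_identity WW' c0_gt0 Wr Wg2 Wri f0 fL.
have Ef : \int[P]_t f (W t) <= 2 * delta.
  rewrite -[leRHS](Rintegral_prob_cst P); apply: le_Rintegral => //.
    exact: Pintegrable_cst.
  move=> t _; rewrite /f.
  have : cl (W t) <= z + delta by apply: clamp_le; lra.
  have : z - delta <= cl 0 by exact: clamp_ge.
  lra.
have Er : \int[P]_t (f (W t) * r (W t)) <= \int[P]_t `|W t * r (W t)|.
  rewrite (le_trans (ler_norm _))//; apply: Rintegral_norm_le => //.
    exact: Pintegrable_norm.
  move=> t; rewrite !normrM ler_wpM2r//.
  by have := fg (W t); rewrite mul1r.
(* The two directions of crossing have equal means, so the pointwise bound on their sum controls
   twice the mean. This 2 cancels the one in [I = 2 A / c0 + 2 B]. *)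
have : \int[P]_t (D t ^+ 2 * crossing z (W t) (W' t)) *+ 2 <=
    \int[P]_t (D t * (f (W t) - f (W' t))).
  rewrite mulr2n -{2}crossing_exchange.
  rewrite -RintegralD//; [|exact: crossingi|exact: crossing'i].
  apply: le_Rintegral => //.
  - by apply: PintegrableD; [exact: crossingi|exact: crossing'i].
  - exact: (lipschitz_increment_integrable Wg2 fL).
  - move=> t _; apply: (le_trans (crossing_le_clamp z (Ddelta t))).
    by rewrite /f -/cl opprB addrA subrK.
move: E Ef Er; set I := \int[P]_t (D t * (f (W t) - f (W' t))).
set C := \int[P]_t (D t ^+ 2 * crossing z (W t) (W' t)).
set A := \int[P]_t f (W t); set B := \int[P]_t (f (W t) * r (W t)).
set B' := \int[P]_t `|W t * r (W t)| => E Ef Er CI.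
have IE : I = 2 * (A / c0) + 2 * B by rewrite E; field; exact: lt0r_neq0.
have : A / c0 <= 2 * delta / c0 by rewrite ler_pM2r// invr_gt0.
rewrite -mulr_natr in CI; lra.
Qed.

(** Multiplied by [c0 / 2], the crossing bound [2 delta / c0 + E |W r(W)|] yields the term [delta]
    and a share [c0 / 2] of [E |W r(W)|]; with the share [c0] of the drift term this makes
    [3 / 2 * c0]. *)
Lemma kolmogorov_bound z :
  `|\int[P]_t below z (W t) - (1 - trunc_exp z 0)| <=
  \int[P]_t `|1 - c0 / 2 * g2 (W t)| + delta + c0 / 2 * delta ^+ 3
  + 3 / 2 * c0 * \int[P]_t `|W t * r (W t)|.
Proof.
have d0 := delta_ge0.
pose f x := trunc_exp z x - trunc_exp z 0.
have f0 : f 0 = 0 by rewrite /f subrr.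
have fL x y : `|f x - f y| <= 1 * `|x - y|.
  by rewrite mul1r /f opprB addrA subrK; exact: trunc_exp_lipschitz.
have fg x : `|f x| <= 1 * `|x| by have := fL x 0; rewrite f0 !subr0.
have mf := lipschitz_measurable fL.
have phi1 x : `|trunc_exp' z x| <= 1.
  by rewrite ger0_norm ?trunc_exp'_ge0// trunc_exp'_le1.
have mphi := measurable_trunc_exp' z.
have [mg2 _ g2i _] := Wg2.
have belowi : Pintegrable P (fun t => below z (W t)).
  apply: (Pintegrable_bounded P (K := 1)).
    exact: measurable_comp_W (measurable_below z).
  by move=> t; rewrite ger0_norm ?below_ge0// below_le1.
have ai : Pintegrable P (fun t => 1 - c0 / 2 * g2 (W t)).
  by apply: PintegrableB; [exact: Pintegrable_cst|exact: PintegrableZ].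
have fri := linear_growth_drift_integrable Wr Wri mf fg.
have -> : \int[P]_t below z (W t) - (1 - trunc_exp z 0) =
    \int[P]_t (trunc_exp' z (W t) - f (W t)).
  rewrite -[X in _ - X](Rintegral_prob_cst P) -RintegralB//; last first.
    exact: Pintegrable_cst.
  by apply: eq_Rintegral => t _; rewrite /trunc_exp' /f; ring.
rewrite (stein_decomposition WW' c0_gt0 Wr Wg2 Wri f0 fL mphi phi1).
set S1 := \int[P]_t (trunc_exp' z (W t) * (1 - c0 / 2 * g2 (W t))).
set S2 := \int[P]_t ((W t - W' t) ^+ 2 * trunc_exp' z (W t)
  - (W t - W' t) * (f (W t) - f (W' t))).
set S3 := \int[P]_t (f (W t) * r (W t)).
have S1b : `|S1| <= \int[P]_t `|1 - c0 / 2 * g2 (W t)|.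
  apply: Rintegral_norm_le.
  - have : Pintegrable P (fun t => (1 - c0 / 2 * g2 (W t)) * trunc_exp' z (W t)).
      apply: (Pintegrable_mul_bounded ai) => [|t]; last exact: phi1.
      exact: measurable_comp_W mphi.
    by apply: eq_integrable => // t _ /=; rewrite mulrC.
  - exact: Pintegrable_norm.
  - by move=> t; rewrite normrM ler_piMl.
have S3b : `|S3| <= \int[P]_t `|W t * r (W t)|.
  apply: Rintegral_norm_le => //; first exact: Pintegrable_norm.
  move=> t; rewrite !normrM ler_wpM2r//.
  by have := fg (W t); rewrite mul1r.
have Si : Pintegrable P (fun t => D t ^+ 2 * trunc_exp' z (W t)
    - D t * (f (W t) - f (W' t))).
  apply: PintegrableB; last exact: (lipschitz_increment_integrable Wg2 fL).
  apply: (Pintegrable_mul_bounded D2i) => [|t]; last exact: phi1.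
  exact: measurable_comp_W mphi.
have D3 t : `|D t| ^+ 3 <= delta ^+ 3.
  by apply: lerXn2r; rewrite ?nnegrE//; exact: Ddelta.
pose B := \int[P]_t `|W t * r (W t)|.
have conc := crossing_concentration z.
have S2b : `|S2| <= delta ^+ 3 + (2 * delta / c0 + B).
  rewrite ler_norml; apply/andP; split.
    (* The lower Taylor estimate involves crossings in the other direction; [crossing_exchange]
       brings them back to the mean bounded by [conc]. *)
    rewrite lerNl -[- S2]mulN1r -RintegralZl//.
    apply: le_trans (lerD (lexx _) conc); rewrite -crossing_exchange.
    rewrite -[X in X + _](Rintegral_prob_cst P) -RintegralD//;
      [|exact: Pintegrable_cst|exact: crossing'i].
    apply: le_Rintegral => //.
    - exact: PintegrableZ.
    - by apply: PintegrableD; [exact: Pintegrable_cst|exact: crossing'i].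
    - move=> t _; rewrite mulN1r.
      apply: le_trans (lerD (D3 t) (lexx _)).
      apply: le_trans (trunc_exp_taylor_lower _ _ _).
      by rewrite lerN2 /f opprB addrA subrK.
  apply: le_trans (lerD (lexx _) conc).
  rewrite -[X in X + _](Rintegral_prob_cst P) -RintegralD//;
    [|exact: Pintegrable_cst|exact: crossingi].
  apply: le_Rintegral => //.
  - by apply: PintegrableD; [exact: Pintegrable_cst|exact: crossingi].
  - move=> t _; apply: le_trans (lerD (D3 t) (lexx _)).
    apply: le_trans (trunc_exp_taylor_upper _ _ _).
    by rewrite /f opprB addrA subrK.
rewrite (le_trans (ler_normD _ _))// (le_trans (lerD (ler_normD _ _) (lexx _)))//.
rewrite !normrM (gtr0_norm c0_gt0) ger0_norm ?invr_ge0//.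
have c2 : 0 < c0 / 2 by rewrite divr_gt0.
have : c0 / 2 * `|S2| <= c0 / 2 * delta ^+ 3 + delta + c0 / 2 * B.
  rewrite (_ : _ + _ = c0 / 2 * (delta ^+ 3 + (2 * delta / c0 + B))).
    by rewrite ler_pM2l.
  by field; exact: lt0r_neq0.
have : c0 * `|S3| <= c0 * B by rewrite ler_pM2l.
rewrite -/B; lra.
Qed.

End kolmogorov_bound.

(** * The exponential law and its memorylessness *)

Section exponential_law.
Context {d : measure_display} {T : measurableType d} {R : realType}.
Variables (Q : probability T R) (Y : {RV Q >-> R}).
Hypothesis YE :
  forall A : set R, measurable A -> Q (Y @^-1` A) = exponential_prob 1 A.

Let mYpre (A : set R) : measurable A -> measurable (Y @^-1` A).
Proof.
move=> mA; rewrite -[X in measurable X]setTI.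
by have : measurable_fun setT Y by []; exact.
Qed.

Let mle x : measurable [set t | Y t <= x].
Proof.
rewrite (_ : [set t | Y t <= x] = Y @^-1` `]-oo, x]).
  by apply: mYpre; exact: measurable_itv.
by apply/seteqP; split => t /=; rewrite in_itv.
Qed.

Let mgt x : measurable [set t | x < Y t].
Proof.
rewrite (_ : [set t | x < Y t] = ~` [set t | Y t <= x]).
  by apply: measurableC; exact: mle.
by apply/seteqP; split => t /=; [rewrite ltNge => /negP|move/negP; rewrite -ltNge].
Qed.

Let mlt x : measurable [set t | Y t < x].
Proof.
rewrite (_ : [set t | Y t < x] = Y @^-1` `]-oo, x[).
  by apply: mYpre; exact: measurable_itv.
by apply/seteqP; split => t /=; rewrite in_itv.
Qed.

Lemma exponential_law_le0 : Q [set t | Y t <= 0] = 0%E.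
Proof.
have -> : [set t | Y t <= 0] = Y @^-1` `]-oo, 0].
  by apply/seteqP; split => t /=; rewrite in_itv.
rewrite YE; last exact: measurable_itv.
rewrite /exponential_prob -integral_itv_bndo_bndc.
  apply: integral0_eq => x /=; rewrite in_itv/= => x0.
  by rewrite lt0_exponential_pdf.
by apply: measurable_funTS; apply/measurable_EFinP; exact: measurable_exponential_pdf.
Qed.

Lemma exponential_law_cdf z :
  Q [set t | Y t <= z] = (1 - trunc_exp z 0)%:E.
Proof.
have [z0|z0] := leP z 0.
  have -> : trunc_exp z 0 = 1.
    by rewrite /trunc_exp min_r ?expR0// sub0r oppr_ge0.
  apply/eqP; rewrite subrr -measure_le0 -exponential_law_le0.
  apply: le_measure; rewrite ?inE; [exact: mle|exact: mle|].
  by move=> t /= /le_trans; exact.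
have -> : [set t | Y t <= z] = (Y @^-1` `[0, z]) `|` [set t | Y t <= 0].
  apply/seteqP; split => t /=; rewrite in_itv/=.
    by have [|/ltW] := leP (Y t) 0; [right|left; apply/andP].
  by case=> [/andP[]//|/le_trans]; apply; exact: ltW.
have -> : Q (Y @^-1` `[0, z] `|` [set t | Y t <= 0]) = Q (Y @^-1` `[0, z]).
  apply: measureU0; [|exact: mle|exact: exponential_law_le0].
  by apply: mYpre; exact: measurable_itv.
rewrite YE; last exact: measurable_itv.
by rewrite exponential_prob_itv0c// trunc_exp_le ?ltW// sub0r mulN1r.
Qed.

Lemma exponential_law_tail z : Q [set t | z < Y t] = (trunc_exp z 0)%:E.
Proof.
have -> : [set t | z < Y t] = ~` [set t | Y t <= z].
  by apply/seteqP; split => t /=; [rewrite ltNge => /negP|move/negP; rewrite -ltNge].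
rewrite probability_setC; last exact: mle.
by rewrite exponential_law_cdf -EFinB opprB addrC subrK.
Qed.

Lemma exponential_law_oc x y : x <= y ->
  Q (Y @^-1` `]x, y]) = (trunc_exp x 0 - trunc_exp y 0)%:E.
Proof.
move=> xy.
have -> : Y @^-1` `]x, y] = [set t | x < Y t] `\` [set t | y < Y t].
  apply/seteqP; split => t /=; rewrite in_itv/=.
    by move=> /andP[-> yt]; split => //; apply/negP; rewrite -leNgt.
  by move=> [-> /negP]; rewrite -leNgt.
have -> : Q ([set t | x < Y t] `\` [set t | y < Y t]) =
    (Q [set t | (x < Y t)%R] - Q [set t | (y < Y t)%R])%E.
  rewrite measureD; [|exact: mgt|exact: mgt|].
    by rewrite setIidr// => t /=; exact: le_lt_trans.
  by rewrite ltey_eq fin_num_measure//; exact: mgt.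
by rewrite !exponential_law_tail.
Qed.

(** Layer cake formula: [E |Y|] is the integral over [s >= 0] of [P(|Y| > s) = e^(-s)]. This tail is
    also the density, so the integral is the total mass 1. The absolute value appears because [Y] is
    positive only almost surely. *)
Lemma exponential_law_abs_mean :
  Pintegrable Q Y /\ (\int[Q]_t `|Y t| <= 1).
Proof.
have mY : measurable_fun setT Y by [].
have mabs : measurable_fun setT (fun t => `|Y t|) by exact: measurableT_comp.
pose X : {RV Q >-> R} := HB.pack (fun t => `|Y t|)
  (isMeasurableFun.Build _ _ _ _ (fun t => `|Y t|) mabs).
have E1 : (\int[Q]_t (`|Y t|)%:E = 1)%E.
  have := @ge0_expectation_ccdf _ _ _ Q X (fun t => normr_ge0 _).
  rewrite unlock => ->.
  have <- : exponential_prob (1 : R) `[0, +oo[ = 1%E.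
    rewrite -YE; last exact: measurable_itv.
    have -> : Y @^-1` `[0, +oo[ = ~` [set t | Y t < 0].
      by apply/seteqP; split => t /=; rewrite in_itv/= andbT leNgt => /negP.
    rewrite probability_setC; last exact: mlt.
    have -> : Q [set t | Y t < 0] = 0%E.
      apply/eqP; rewrite -measure_le0 -exponential_law_le0.
      apply: le_measure; rewrite ?inE; [exact: mlt|exact: mle|].
      by move=> t /= /ltW.
    by rewrite sube0.
  apply: eq_integral => s; rewrite inE/= in_itv/= andbT => s0.
  rewrite exponential_pdfE// mul1r mulN1r /ccdf /distribution /pushforward.
  have -> : X @^-1` `]s, +oo[ = [set t | s < Y t] `|` [set t | Y t < - s].
    apply/seteqP; split => t /=; rewrite in_itv/= andbT /X/= lter_normr.
      by case/orP; [left|right => /=; rewrite ltrNr].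
    by case=> [->//|]; rewrite ltrNr => ->; rewrite orbT.
  have -> : Q ([set t | s < Y t] `|` [set t | Y t < - s]) = Q [set t | s < Y t].
    apply: measureU0; [exact: mgt|exact: mlt|].
    apply/eqP; rewrite -measure_le0 -exponential_law_le0.
    apply: le_measure; rewrite ?inE; [exact: mlt|exact: mle|].
    by move=> t /= /ltW/le_trans; apply; rewrite oppr_le0.
  by rewrite exponential_law_tail trunc_exp_le// sub0r.
split; last by rewrite /Rintegral E1.
apply/integrableP; split; first exact/measurable_EFinP.
by rewrite /= E1 ltry.
Qed.

End exponential_law.

Section exponential_law_excess.
Context {d : measure_display} {T : measurableType d} {R : realType}.
Variables (Q : probability T R) (Y : {RV Q >-> R}).
Hypothesis YE :
  forall A : set R, measurable A -> Q (Y @^-1` A) = exponential_prob 1 A.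
Variable a : R.
Hypothesis a_ge0 : 0 <= a.

Let mX : measurable_fun setT (fun t => a + Y t).
Proof. exact: measurable_funD. Qed.

Let X : {RV Q >-> R} := HB.pack (fun t => a + Y t)
  (isMeasurableFun.Build _ _ _ _ (fun t => a + Y t) mX).

Let k : {nonneg R} := NngNum (expR_ge0 (- a)).

Let I : set R := `]a, +oo[%classic.

Let mI : measurable I.
Proof. exact: measurable_itv. Qed.

(** Memorylessness at the level of measures: on []a, +oo[] the law of [Y] is [e^(-a)] times the law
    of [a + Y]. Two such finite measures agree once they agree on the half-open intervals []x, y]],
    where both are explicit. *)
Let excess_law (A : set R) : measurable A ->
  mrestr (distribution Q Y) mI A = mscale k (mrestr (distribution Q X) mI) A.
Proof.
move: A; apply: (measure_unique (@ocitv R) (fun n => `]- n%:R, n%:R]%classic)).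
- by [].
- exact: ocitvI.
- by move=> n; exact: is_ocitv.
- rewrite -subTset => /= x _ /=.
  exists (Num.Def.archi_bound `|x|) => //=; rewrite in_itv/=.
  by have := archi_boundP (normr_ge0 x); rewrite ltr_norml => /andP[-> /ltW].
- move=> _ [[x y] _ <-] /=.
  rewrite /mscale/= /mrestr /distribution /pushforward.
  have -> : `]x, y]%classic `&` I = `]Num.max x a, y]%classic.
    rewrite /I; apply/seteqP; split => z /=; rewrite !in_itv/= gt_max.
      by rewrite andbT => -[/andP[-> ->] ->].
    by move=> /andP[/andP[-> ->] ->].
  have -> : X @^-1` `]Num.max x a, y] =
      Y @^-1` `]Num.max x a - a, y - a].
    by apply/seteqP; split => t /=; rewrite !in_itv/= ltrBlDl lerBrDl.
  have am : a <= Num.max x a by rewrite le_max lexx orbT.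
  have [my|my] := leP (Num.max x a) y; last first.
    rewrite !set_itv_ge ?preimage_set0 ?measure0 ?mule0//.
      by rewrite bnd_simp -leNgt lerB// ltW.
    by rewrite bnd_simp -leNgt ltW.
  rewrite !(exponential_law_oc YE)//; last by rewrite lerB.
  have m0 := le_trans a_ge0 am; have y0 := le_trans m0 my.
  have ma0 : 0 <= Num.max x a - a by rewrite subr_ge0.
  have ya0 : 0 <= y - a by rewrite subr_ge0 (le_trans am).
  rewrite -EFinM !trunc_exp_le//.
  congr EFin; rewrite mulrBr -!expRD; congr (expR _ - expR _); ring.
- move=> n; rewrite (le_lt_trans _ (ltry 1))// /mrestr.
  by apply: probability_le1; apply: measurableI => //; exact: measurable_itv.
Qed.

(** [a + Y] exceeds [a] exactly when [Y > 0], hence off a null event; this is why no restriction to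
    [I] remains on the right. *)
Lemma ge0_exponential_law_excess (G : R -> \bar R) :
  measurable_fun setT G -> (forall x, (0 <= G x)%E) ->
  (\int[Q]_(t in Y @^-1` I) G (Y t) =
   (expR (- a))%:E * \int[Q]_t G (a + Y t)%R)%E.
Proof.
move=> mG G0.
have mY : measurable_fun setT Y by [].
have mGI : measurable_fun I G by exact: measurable_funTS.
have := @ge0_integral_pushforward _ _ _ _ _ _ mY Q I G mI mGI (fun x _ => G0 x).
rewrite /comp => <-.
transitivity (\int[mscale k (distribution Q X)]_(y in I) G y)%E.
  apply: eq_measure_integral => A mA AI.
  by have := excess_law mA; rewrite /mscale/= /mrestr !setIidl.
rewrite ge0_integral_mscale//; congr (_ * _)%E.
have := @ge0_integral_pushforward _ _ _ _ _ _ mX Q I G mI mGI (fun x _ => G0 x).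
rewrite /comp => ->.
have E0 := exponential_law_le0 YE.
have -> : (fun t => a + Y t) @^-1` I = setT `\` [set t | Y t <= 0].
  apply/seteqP; split => t /=; rewrite /I/= in_itv/= andbT ltrDl.
    by move=> Y0; split => //; apply/negP; rewrite -ltNge.
  by move=> [_ /negP]; rewrite -ltNge.
apply/esym; apply: ge0_negligible_integral => //.
- rewrite (_ : [set t | Y t <= 0] = Y @^-1` `]-oo, 0]).
    rewrite -[X in measurable X]setTI.
    by apply: mY => //; exact: measurable_itv.
  by apply/seteqP; split => t /=; rewrite in_itv.
- exact: measurableT_comp.
Qed.

Lemma exponential_law_excess (f : R -> R) : measurable_fun setT f ->
  Pintegrable Q (fun t => f (Y t)) -> Pintegrable Q (fun t => f (a + Y t)) ->
  \int[Q]_t ((1 - below a (Y t)) * f (Y t)) =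
  expR (- a) * \int[Q]_t f (a + Y t).
Proof.
move=> mf fi fai.
have mIY : measurable (Y @^-1` I).
  rewrite -[X in measurable X]setTI.
  by have : measurable_fun setT Y by []; exact.
have -> : \int[Q]_t ((1 - below a (Y t)) * f (Y t)) =
    \int[Q]_(t in Y @^-1` I) f (Y t).
  rewrite [RHS]Rintegral_mkcond; apply: eq_Rintegral => t _; rewrite patchE.
  rewrite /below; case: (leP (Y t) a) => Ya.
    rewrite subrr mul0r memNset// /I/= in_itv/= andbT.
    by apply/negP; rewrite -leNgt.
  by rewrite subr0 mul1r mem_set// /I/= in_itv/= andbT.
rewrite /Rintegral.
have mEf : measurable_fun setT (EFin \o f) by exact/measurable_EFinP.
have -> : (\int[Q]_(t in Y @^-1` I) (f (Y t))%:E =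
    (expR (- a))%:E * \int[Q]_t (f (a + Y t))%:E)%E.
  rewrite integralE [in RHS]integralE.
  have -> : (\int[Q]_(t in Y @^-1` I) (fun t => (f (Y t))%:E)^\+ t =
      (expR (- a))%:E * \int[Q]_t (fun t => (f (a + Y t))%:E)^\+ t)%E.
    have := ge0_exponential_law_excess (measurable_funepos mEf)
      (fun x => funepos_ge0 _ x).
    by rewrite unlock.
  have -> : (\int[Q]_(t in Y @^-1` I) (fun t => (f (Y t))%:E)^\- t =
      (expR (- a))%:E * \int[Q]_t (fun t => (f (a + Y t))%:E)^\- t)%E.
    have := ge0_exponential_law_excess (measurable_funeneg mEf)
      (fun x => funeneg_ge0 _ x).
    by rewrite unlock.
  apply/esym; apply: muleBr => //; apply: fin_num_adde_defl.
  by rewrite fin_numN; exact: integrable_neg_fin_num.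
rewrite fineM//; exact: integrable_fin_num.
Qed.

End exponential_law_excess.

(** * Smoothing of [h] by an exponential variable, with its Taylor estimate *)

Section exponential_stein_solution.
Context {d : measure_display} {T : measurableType d} {R : realType}.
Variables (Q : probability T R) (Y : {RV Q >-> R}).
Hypothesis YE :
  forall A : set R, measurable A -> Q (Y @^-1` A) = exponential_prob 1 A.
Variables (h : R -> R) (M : R).
Hypothesis M_ge0 : 0 <= M.
Hypothesis hL : forall x y, `|h x - h y| <= M * `|x - y|.
Implicit Types a v w : R.

(** In closed form this is [e^w] times the integral of [h(x) e^(-x)] over [x > w], the solution of
    [H' = H - h] of at most linear growth. *)
Definition exp_smoothing w := \int[Q]_t h (w + Y t).

Local Notation H := exp_smoothing.

Let Yi : Pintegrable Q Y := (exponential_law_abs_mean YE).1.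

Let EY : \int[Q]_t `|Y t| <= 1 := (exponential_law_abs_mean YE).2.

Let mh : measurable_fun setT h.
Proof. exact: lipschitz_measurable hL. Qed.

Lemma exponential_shift_integrable w : Pintegrable Q (fun t => h (w + Y t)).
Proof.
apply: (@Pintegrable_le _ _ _ _ _ (fun t => `|h w| + M * `|Y t|)).
- by apply: (measurableT_comp mh); exact: measurable_funD.
- move=> t; have := hL (w + Y t) w.
  rewrite [w + Y t - w]addrC addKr -lerBlDl; apply: le_trans.
  exact: lerB_dist.
- apply: PintegrableD; first exact: Pintegrable_cst.
  exact/PintegrableZ/Pintegrable_norm.
Qed.

Lemma exp_smoothing_lipschitz x y : `|H x - H y| <= M * `|x - y|.
Proof.
rewrite -RintegralB//; [|exact: exponential_shift_integrable|exact: exponential_shift_integrable].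
rewrite -[leRHS](Rintegral_prob_cst Q); apply: Rintegral_norm_le.
- by apply: PintegrableB; exact: exponential_shift_integrable.
- exact: Pintegrable_cst.
- by move=> t; rewrite (le_trans (hL _ _))// opprD addrACA subrr addr0.
Qed.

Lemma exp_smoothing_dist w : `|h w - H w| <= M.
Proof.
rewrite -[h w](Rintegral_prob_cst Q) -RintegralB//;
  [|exact: Pintegrable_cst|exact: exponential_shift_integrable].
apply: (@le_trans _ _ (\int[Q]_t (M * `|Y t|))).
  apply: Rintegral_norm_le.
  - by apply: PintegrableB; [exact: Pintegrable_cst|exact: exponential_shift_integrable].
  - exact/PintegrableZ/Pintegrable_norm.
  - by move=> t; rewrite (le_trans (hL _ _))// opprD addrA subrr add0r normrN.
by rewrite RintegralZl ?ler_piMr//; exact: Pintegrable_norm.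
Qed.

Let mbelow a : measurable_fun setT (fun t => below a (Y t)).
Proof. by apply: (measurableT_comp (measurable_below a)). Qed.

Let below1 a t : `|below a (Y t)| <= 1.
Proof. by rewrite ger0_norm ?below_ge0// below_le1. Qed.

Let belowi a : Pintegrable Q (fun t => below a (Y t)).
Proof. by apply: (Pintegrable_bounded Q (mbelow a)); exact: below1. Qed.

Let below_mean a : 0 <= a -> \int[Q]_t below a (Y t) = 1 - expR (- a).
Proof.
move=> a0.
have e := exponential_law_excess YE a0 (measurable_cst (1 : R))
  (Pintegrable_cst Q 1) (Pintegrable_cst Q 1).
have : \int[Q]_t (1 - below a (Y t)) = expR (- a).
  rewrite -[RHS]mulr1 -[X in _ * X](Rintegral_prob_cst Q) -e.
  by apply: eq_Rintegral => t _; rewrite mulr1.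
rewrite RintegralB//; [|exact: Pintegrable_cst|exact: belowi].
by rewrite Rintegral_prob_cst => <-; rewrite opprB addrC subrK.
Qed.

(** The excess law at [a = 0]: this is how the almost sure positivity of [Y] enters integrals. *)
Let below0_mul (f : R -> R) : measurable_fun setT f ->
  Pintegrable Q (fun t => f (Y t)) ->
  \int[Q]_t (f (Y t) * below 0 (Y t)) = 0.
Proof.
move=> mf fi.
have fi0 : Pintegrable Q (fun t => f (0 + Y t)).
  by apply: eq_integrable fi => // t _ /=; rewrite add0r.
have := exponential_law_excess YE (lexx 0) mf fi fi0.
rewrite oppr0 expR0 mul1r.
have -> : \int[Q]_t f (0 + Y t) = \int[Q]_t f (Y t).
  by apply: eq_Rintegral => t _; rewrite add0r.
have bi : Pintegrable Q (fun t => f (Y t) * below 0 (Y t)).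
  exact: (Pintegrable_mul_bounded fi (mbelow 0) (below1 0)).
have -> : \int[Q]_t ((1 - below 0 (Y t)) * f (Y t)) =
    \int[Q]_t f (Y t) - \int[Q]_t (f (Y t) * below 0 (Y t)).
  by rewrite -RintegralB//; apply: eq_Rintegral => t _; ring.
lra.
Qed.

(** On [0 < Y <= a] the points [w + Y] and [v] both lie in [[w, w + a]], and the event [Y <= a] has
    probability [1 - e^(-a)]. On [Y <= 0] the integrand is dominated with an additional [M |Y|],
    whose integral over that event is 0. *)
Let local_error a w v : 0 <= a -> w <= v <= w + a ->
  `|\int[Q]_t ((h (w + Y t) - h v) * below a (Y t))| <=
  M * a * (1 - expR (- a)).
Proof.
move=> a0 /andP[wv va].
have mabs : measurable_fun setT (fun x : R => `|x|) by [].
have nYi := Pintegrable_norm Yi.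
have bi : Pintegrable Q (fun t => `|Y t| * below 0 (Y t)).
  exact: (Pintegrable_mul_bounded nYi (mbelow 0) (below1 0)).
apply: (@le_trans _ _ (\int[Q]_t (M * a * below a (Y t)
    + M * (`|Y t| * below 0 (Y t))))); last first.
  rewrite RintegralD//; [|exact/PintegrableZ/belowi|exact: PintegrableZ].
  rewrite RintegralZl//; last exact: belowi.
  by rewrite RintegralZl// (below0_mul mabs nYi) mulr0 addr0 below_mean.
apply: Rintegral_norm_le.
- apply: (Pintegrable_mul_bounded _ (mbelow a) (below1 a)).
  by apply: PintegrableB; [exact: exponential_shift_integrable|exact: Pintegrable_cst].
- by apply: PintegrableD; apply: PintegrableZ => //; exact: belowi.
- move=> t; rewrite normrM (ger0_norm (below_ge0 _ _)).
  have := hL (w + Y t) v; rewrite /below.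
  case: (leP (Y t) a) => Ya /=; last first.
    by rewrite !mulr0 add0r; case: (leP (Y t) 0) => Y0 /=; nra.
  rewrite !mulr1; move=> /le_trans; apply.
  rewrite -mulrDr ler_wpM2l//; case: (leP (Y t) 0) => Y0 /=.
    by rewrite mulr1 (ler0_norm Y0) ler_norml; apply/andP; split; lra.
  by rewrite mulr0 addr0 ler_norml; apply/andP; split; lra.
Qed.

(* Memorylessness: conditionally on [Y > a], [Y] is distributed as [a + Y]. *)
Let smoothing_step a w v : 0 <= a -> w <= v <= w + a ->
  `|H w - H (w + a) - (1 - expR (- a)) * (h v - H (w + a))| <= M * a ^+ 2.
Proof.
move=> a0 wva.
have ea : 0 <= 1 - expR (- a) <= a.
  have := expR_ge1Dx (- a); have : expR (- a) <= 1.
    by rewrite -expR0 ler_expR oppr_le0.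
  by move=> *; apply/andP; split; lra.
apply: (le_trans _ (_ : M * a * (1 - expR (- a)) <= _)); last first.
  by rewrite expr2 mulrA ler_wpM2l ?mulr_ge0//; case/andP: ea.
apply: le_trans (local_error a0 wva).
rewrite le_eqVlt; apply/orP; left; apply/eqP; congr `|_|.
have bi : Pintegrable Q (fun t => h (w + Y t) * below a (Y t)).
  exact: (Pintegrable_mul_bounded (exponential_shift_integrable w) (mbelow a) (below1 a)).
have -> : \int[Q]_t ((h (w + Y t) - h v) * below a (Y t)) =
    \int[Q]_t (h (w + Y t) * below a (Y t)) - h v * (1 - expR (- a)).
  rewrite -below_mean// -RintegralZl//; last exact: belowi.
  rewrite -RintegralB//; last exact/PintegrableZ/belowi.
  by apply: eq_Rintegral => t _; rewrite mulrBl.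
have mhw : measurable_fun setT (fun y => h (w + y)).
  by apply: (measurableT_comp mh); exact: measurable_funD.
have hwa : Pintegrable Q (fun t => h (w + (a + Y t))).
  by apply: eq_integrable (exponential_shift_integrable (w + a)) => // t _ /=; rewrite addrA.
have := exponential_law_excess YE a0 mhw (exponential_shift_integrable w) hwa.
have -> : \int[Q]_t h (w + (a + Y t)) = H (w + a).
  by apply: eq_Rintegral => t _; rewrite addrA.
have -> : \int[Q]_t ((1 - below a (Y t)) * h (w + Y t)) =
    H w - \int[Q]_t (h (w + Y t) * below a (Y t)).
  rewrite -RintegralB//; last exact: exponential_shift_integrable.
  by apply: eq_Rintegral => t _; ring.
lra.
Qed.

Let expRN_bounds a : 0 <= a -> 0 <= a - (1 - expR (- a)) <= a ^+ 2.
Proof.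
move=> a0; have h1 := expR_ge1Dx (- a); have h2 := expR_ge1Dx a.
have e1 : expR (- a) * expR a = 1 by rewrite -expRD addNr expR0.
have e0 := expR_gt0 (- a).
have h3 : expR (- a) * (1 + a) <= 1 by rewrite -[leRHS]e1 ler_pM2l.
apply/andP; split; first lra.
(* Multiplying by [1 + a > 0] works because [(1 - a + a^2) (1 + a) = 1 + a^3]. *)
have : (expR (- a) - (1 - a + a ^+ 2)) * (1 + a) <= 0.
  have : 0 <= a ^+ 3 by rewrite exprn_ge0.
  nra.
rewrite pmulr_lle0; lra.
Qed.

(** Expansion at the right end [w + a]. One [M a^2] comes from [smoothing_step], the other from
    replacing [1 - e^(-a)] by [a] in front of [h - H], which is at most [M]. *)
Let taylor_right a w : 0 <= a ->
  `|a * (h (w + a) - H (w + a)) - (H w - H (w + a))| <= 2 * M * a ^+ 2.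
Proof.
move=> a0; have wa : w <= w + a <= w + a by rewrite lexx lerDl a0.
have s := smoothing_step a0 wa.
have /andP[e0 e1] := expRN_bounds a0.
have q := exp_smoothing_dist (w + a).
set x := H w - H (w + a) in s *; set y := h (w + a) - H (w + a) in s q *.
rewrite [X in `|X|](_ : _ = (a - (1 - expR (- a))) * y
  - (x - (1 - expR (- a)) * y)); last by ring.
rewrite (le_trans (ler_normB _ _))// normrM (ger0_norm e0).
have : (a - (1 - expR (- a))) * `|y| <= a ^+ 2 * M by exact: ler_pM.
lra.
Qed.

(** At the left end a third [M a^2] appears: [smoothing_step] refers to [H (w + a)], and returning
    to [H w] costs a Lipschitz increment of [H] times [1 - e^(-a)]. *)
Let taylor_left_crude a w : 0 <= a ->
  `|a * (h w - H w) - (H w - H (w + a))| <= 3 * M * a ^+ 2.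
Proof.
move=> a0; have wa : w <= w <= w + a by rewrite lexx lerDl a0.
have s := smoothing_step a0 wa.
have /andP[e0 e1] := expRN_bounds a0.
have q := exp_smoothing_dist w.
have l := exp_smoothing_lipschitz w (w + a).
rewrite opprD addrA subrr add0r normrN (ger0_norm a0) in l.
have e2 : 0 <= 1 - expR (- a).
  by rewrite subr_ge0 -expR0 ler_expR oppr_le0.
have e3 : 1 - expR (- a) <= a by lra.
set x := H w - H (w + a) in s l *; set y := h w - H w in q *.
rewrite [X in `|X|](_ : _ = (a - (1 - expR (- a))) * y
  - (1 - expR (- a)) * x
  - (x - (1 - expR (- a)) * (h w - H (w + a)))); last by rewrite /x /y; ring.
rewrite (le_trans (ler_normB _ _))//.
have := ler_normB ((a - (1 - expR (- a))) * y) ((1 - expR (- a)) * x).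
rewrite !normrM (ger0_norm e0) (ger0_norm e2).
have : (a - (1 - expR (- a))) * `|y| <= a ^+ 2 * M by exact: ler_pM.
have : (1 - expR (- a)) * `|x| <= a * (M * a) by exact: ler_pM.
rewrite -[a * (M * a)]mulrCA -expr2; lra.
Qed.

(* Halving the step once brings the constant down from 3 to 2. *)
Let taylor_left a w : 0 <= a ->
  `|a * (h w - H w) - (H w - H (w + a))| <= 2 * M * a ^+ 2.
Proof.
move=> a0; have b0 : 0 <= a / 2 by rewrite divr_ge0.
have s1 := taylor_left_crude w b0.
have s2 := taylor_left_crude (w + a / 2) b0.
have l1 := exp_smoothing_lipschitz w (w + a / 2).
have l2 := hL w (w + a / 2).
have wa : w + a / 2 + a / 2 = w + a by rewrite -addrA -splitr.
rewrite wa in s2.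
rewrite opprD addrA subrr add0r normrN (ger0_norm b0) in l1 l2.
set v := w + a / 2 in s1 s2 l1 l2.
(* The two half steps cost [2 * 3 M (a / 2)^2 = 3/2 M a^2]; moving the base point of the second one
   from [v] to [w] costs [M a^2 / 2]. *)
rewrite [X in `|X|](_ : _ = (a / 2 * (h w - H w) - (H w - H v))
  + (a / 2 * (h v - H v) - (H v - H (w + a)))
  + a / 2 * ((h w - h v) - (H w - H v))); last by field.
rewrite (le_trans (ler_normD _ _))// (le_trans (lerD (ler_normD _ _) (lexx _)))//.
rewrite normrM (ger0_norm b0).
have : a / 2 * `|h w - h v - (H w - H v)| <= a / 2 * (M * (a / 2) + M * (a / 2)).
  by rewrite ler_wpM2l// (le_trans (ler_normB _ _))// lerD.
lra.
Qed.

(** The constant 2 is what the factor [c0 / 2] of the Stein decomposition turns into the coefficient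
    [c0] of [E |D|^3]. *)
Lemma exp_smoothing_taylor w w' :
  `|(w - w') * (h w - H w) - (H w' - H w)| <= 2 * M * (w - w') ^+ 2.
Proof.
have [ww'|/ltW ww'] := leP w w'.
  have a0 : 0 <= w' - w by rewrite subr_ge0.
  have := taylor_left w a0; rewrite subrKC -sqrrN opprB.
  by rewrite -normrN; congr (`|_| <= _); ring.
have a0 : 0 <= w - w' by rewrite subr_ge0.
by have := taylor_right w' a0; rewrite subrKC.
Qed.

End exponential_stein_solution.

(** * The Wasserstein bound and the conclusion *)

Section wasserstein_bound.
Context {d : measure_display} {T : measurableType d} {R : realType}.
Variables (P : probability T R) (W W' : {RV P >-> R}) (c0 : R) (r g2 : R -> R).
Context {d' : measure_display} {T' : measurableType d'}.
Variables (Q : probability T' R) (Y : {RV Q >-> R}).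
Hypothesis WW' : exchangeable P W W'.
Hypothesis c0_gt0 : 0 < c0.
Hypothesis Wr :
  cond_exp_given P W (fun t => W t - W' t) (fun w => c0^-1 + r w).
Hypothesis Wg2 : cond_exp_given P W (fun t => (W t - W' t) ^+ 2) g2.
Hypothesis Wri : Pintegrable P (fun t => W t * r (W t)).
Hypothesis D3i : Pintegrable P (fun t => `|W t - W' t| ^+ 3).
Hypothesis YE :
  forall A : set R, measurable A -> Q (Y @^-1` A) = exponential_prob 1 A.
Variables (h : R -> R) (M : R).
Hypothesis M_ge0 : 0 <= M.
Hypothesis hL : forall x y, `|h x - h y| <= M * `|x - y|.

Let D t := W t - W' t.

Lemma wasserstein_bound :
  `|\int[P]_t h (W t) - \int[Q]_t h (Y t)| <=
  M * (\int[P]_t `|1 - c0 / 2 * g2 (W t)| + c0 * \int[P]_t (`|W t - W' t| ^+ 3)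
       + c0 * \int[P]_t `|W t * r (W t)|).
Proof.
pose H := exp_smoothing Y h.
pose f x := H 0 - H x; pose phi x := h x - H x.
have HL := exp_smoothing_lipschitz YE hL.
have f0 : f 0 = 0 by rewrite /f subrr.
have fL x y : `|f x - f y| <= M * `|x - y|.
  rewrite /f (_ : _ - _ = - (H x - H y)); last by ring.
  by rewrite normrN; exact: HL.
have fg x : `|f x| <= M * `|x| by have := fL x 0; rewrite f0 !subr0.
have mf := lipschitz_measurable fL.
have mphi : measurable_fun setT phi.
  by apply: measurable_funB; [exact: lipschitz_measurable hL|exact: lipschitz_measurable HL].
have phiM x : `|phi x| <= M := exp_smoothing_dist YE M_ge0 hL x.
have [mg2 D2i g2i _] := Wg2.
have hWi := lipschitz_integrable WW' c0_gt0 Wr Wg2 Wri hL.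
have ai : Pintegrable P (fun t => 1 - c0 / 2 * g2 (W t)).
  by apply: PintegrableB; [exact: Pintegrable_cst|exact: PintegrableZ].
have fri := linear_growth_drift_integrable Wr Wri mf fg.
have -> : \int[P]_t h (W t) - \int[Q]_t h (Y t) =
    \int[P]_t (phi (W t) - f (W t)).
  have -> : \int[Q]_t h (Y t) = \int[P]_t H 0.
    rewrite Rintegral_prob_cst; apply: eq_Rintegral => t _.
    by rewrite add0r.
  rewrite -RintegralB//; last exact: Pintegrable_cst.
  by apply: eq_Rintegral => t _; rewrite /phi /f; ring.
rewrite (stein_decomposition WW' c0_gt0 Wr Wg2 Wri f0 fL mphi phiM).
set S1 := \int[P]_t (phi (W t) * (1 - c0 / 2 * g2 (W t))).
set S2 := \int[P]_t ((W t - W' t) ^+ 2 * phi (W t)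
  - (W t - W' t) * (f (W t) - f (W' t))).
set S3 := \int[P]_t (f (W t) * r (W t)).
have S1b : `|S1| <= M * \int[P]_t `|1 - c0 / 2 * g2 (W t)|.
  rewrite -RintegralZl//; last exact: Pintegrable_norm.
  apply: Rintegral_norm_le.
  - have : Pintegrable P (fun t => (1 - c0 / 2 * g2 (W t)) * phi (W t)).
      apply: (Pintegrable_mul_bounded ai) => [|t]; last exact: phiM.
      exact: measurable_comp_W mphi.
    by apply: eq_integrable => // t _ /=; rewrite mulrC.
  - exact/PintegrableZ/Pintegrable_norm.
  - by move=> t; rewrite normrM ler_wpM2r.
have S3b : `|S3| <= M * \int[P]_t `|W t * r (W t)|.
  rewrite -RintegralZl//; last exact: Pintegrable_norm.
  apply: Rintegral_norm_le => //; first exact/PintegrableZ/Pintegrable_norm.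
  by move=> t; rewrite !normrM mulrA ler_wpM2r.
have S2b : `|S2| <= 2 * M * \int[P]_t (`|W t - W' t| ^+ 3).
  rewrite -RintegralZl//; apply: Rintegral_norm_le.
  - apply: PintegrableB; last exact: (lipschitz_increment_integrable Wg2 fL).
    apply: (Pintegrable_mul_bounded D2i) => [|t]; last exact: phiM.
    exact: measurable_comp_W mphi.
  - exact: PintegrableZ.
  - move=> t; rewrite -/(D t).
    (* One factor [D] is taken out, so that the bracket is the first-order remainder of [H] at [W],
       of size [2 M D^2]. *)
    rewrite [X in `|X|](_ : _ = D t * (D t * phi (W t) - (H (W' t) - H (W t)))).
      rewrite normrM exprS mulrCA ler_wpM2l// real_normK ?num_real//.
      exact: (exp_smoothing_taylor YE M_ge0 hL).
    by rewrite /f; ring.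
rewrite (le_trans (ler_normD _ _))// (le_trans (lerD (ler_normD _ _) (lexx _)))//.
rewrite !normrM (gtr0_norm c0_gt0) ger0_norm ?invr_ge0//.
have c2 : 0 < c0 / 2 by rewrite divr_gt0.
have := ler_wpM2l (ltW c2) S2b; have := ler_wpM2l (ltW c0_gt0) S3b.
lra.
Qed.

End wasserstein_bound.

Lemma EFin_Rintegral {d : measure_display} {T : measurableType d} {R : realType}
    (P : probability T R) (f : T -> R) : Pintegrable P f ->
  (\int[P]_t (f t)%:E)%E = (\int[P]_t f t)%:E.
Proof. by move=> fi; rewrite /Rintegral fineK//; exact: integrable_fin_num. Qed.

Lemma Pintegrable_ge0 {d : measure_display} {T : measurableType d} {R : realType}
    (P : probability T R) (f : T -> R) : measurable_fun setT f ->
  (forall t, 0 <= f t) -> (\int[P]_t (f t)%:E < +oo)%E -> Pintegrable P f.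
Proof.
move=> mf f0 fi; apply/integrableP; split; first exact/measurable_EFinP.
by under eq_integral => t _ do rewrite /= ger0_norm//.
Qed.

Lemma Rintegral_below {d : measure_display} {T : measurableType d} {R : realType}
    (P : probability T R) (W : {RV P >-> R}) (z : R) :
  P [set t | W t <= z] = (\int[P]_t below z (W t))%:E.
Proof.
have mA : measurable [set t | W t <= z].
  rewrite (_ : [set t | W t <= z] = setT `&` W @^-1` `]-oo, z]).
    have mW : measurable_fun setT W by [].
    by apply: mW => //; exact: measurable_itv.
  by rewrite setTI; apply/seteqP; split => t /=; rewrite in_itv.
rewrite -EFin_Rintegral; last first.
  apply: (Pintegrable_bounded P (K := 1)).
    exact: measurable_comp_W (measurable_below z).
  by move=> t; rewrite ger0_norm ?below_ge0// below_le1.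
rewrite -[LHS](_ : P ([set t | W t <= z] `&` setT) = _); last by rewrite setIT.
rewrite -integral_indic//; apply: eq_integral => t _; congr EFin.
rewrite indicE /below; congr (_%:R); congr nat_of_bool.
by apply/idP/idP; rewrite inE.
Qed.

Theorem theorem3p1 (R : realType)
  (d : measure_display) (T : measurableType d) (P : probability T R)
  (W W' : {RV P >-> R})
  (c0 : R) (r : R -> R)
  (g2 : R -> R)
  (d' : measure_display) (T' : measurableType d') (Q : probability T' R)
  (Y : {RV Q >-> R}) :
  exchangeable P W W' ->
  0 < c0 ->
  measurable_fun setT r ->
  cond_exp_given P W (fun t => W t - W' t) (fun w => c0^-1 + r w) ->
  cond_exp_given P W (fun t => (W t - W' t) ^+ 2) g2 ->
  (forall A : set R, measurable A -> Q (Y @^-1` A) = exponential_prob 1 A) ->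
  (* (i) *)
  (forall (h : R -> R) (M : R),
     abs_cont_R h ->
     (forall x, derivable h x 1 -> `|derive1 h x| <= M) ->
     (`| \int[P]_t (h (W t))%:E - \int[Q]_t (h (Y t))%:E |
      <= M%:E * (\int[P]_t (`|1 - c0 / 2 * g2 (W t)|)%:E
                 + c0%:E * \int[P]_t (`|W t - W' t| ^+ 3)%:E
                 + (3 * c0)%:E * \int[P]_t (`|W t * r (W t)|)%:E))%E)
  /\
  (* (ii) *)
  (forall delta : R,
     (forall t, `|W t - W' t| <= delta) ->
     forall z : R,
     (`| P [set t | (W t <= z)%R] - Q [set t | (Y t <= z)%R] |
      <= 3%:E * \int[P]_t (`|1 - c0 / 2 * g2 (W t)|)%:E
         + delta%:E + (2 * c0 * delta ^+ 3)%:E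
         + (3 * c0)%:E * \int[P]_t (`|W t * r (W t)|)%:E)%E).
Proof.
move=> WW' c0_gt0 mr Wr Wg2 YE.
have mW : measurable_fun setT W by [].
have mrW : measurable_fun setT (fun t => W t * r (W t)).
  by apply: measurable_funM => //; exact: measurable_comp_W.
have mnrW : measurable_fun setT (fun t => `|W t * r (W t)|).
  exact: measurableT_comp.
have mD3 : measurable_fun setT (fun t => `|W t - W' t| ^+ 3).
  by apply: measurable_funX; apply: measurableT_comp => //; exact: measurable_funB.
have [_ _ g2i _] := Wg2.
have ai : Pintegrable P (fun t => `|1 - c0 / 2 * g2 (W t)|).
  apply: Pintegrable_norm.
  by apply: PintegrableB; [exact: Pintegrable_cst|exact: PintegrableZ].
have Wr_ge0 : (0 <= \int[P]_t (`|W t * r (W t)|)%:E)%E by exact: integral_ge0.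
have D3_ge0 : (0 <= \int[P]_t (`|W t - W' t| ^+ 3)%:E)%E.
  by apply: integral_ge0 => t _; rewrite lee_fin exprn_ge0.
have Wri : (\int[P]_t (`|W t * r (W t)|)%:E < +oo)%E ->
    Pintegrable P (fun t => W t * r (W t)).
  move=> /(Pintegrable_ge0 mnrW (fun t => normr_ge0 _)) i.
  by apply: (Pintegrable_le mrW _ i).
have c3 : 0 < 3 * c0 by rewrite mulr_gt0.
rewrite (EFin_Rintegral ai).
set A := \int[P]_t `|1 - c0 / 2 * g2 (W t)|.
have A_ge0 : 0 <= A by exact: Rintegral_ge0.
split=> [h M hac hM|delta Ddelta z]; last first.
  rewrite Rintegral_below (exponential_law_cdf YE).
  (* An infinite [E |W r(W)|] makes the right side [+oo], since its coefficient is positive;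
     otherwise [W r(W)] is integrable and real-valued bounds apply. *)
  have [Woo|Woo] := ltP (\int[P]_t (`|W t * r (W t)|)%:E)%E +oo%E; last first.
    move: Woo; rewrite leye_eq => /eqP ->.
    by rewrite gt0_muley// addey// leey.
  have {}Wri := Wri Woo.
  have d0 := delta_ge0 Ddelta.
  rewrite (EFin_Rintegral (Pintegrable_norm Wri)).
  rewrite -EFinB -!EFinM -!EFinD lee_fin.
  (* This bound has constants 1, 1, 1/2 and 3/2 where 3, 1, 2 and 3 are claimed; nonnegativity of
     the terms absorbs the difference. *)
  have := kolmogorov_bound WW' c0_gt0 Wr Wg2 Wri Ddelta z.
  have B_ge0 : 0 <= c0 * \int[P]_t `|W t * r (W t)|.
    by apply: mulr_ge0; [exact: ltW|exact: Rintegral_ge0].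
  have d3 : 0 <= c0 * delta ^+ 3 by rewrite mulr_ge0 ?exprn_ge0// ltW.
  rewrite -/A; lra.
have [M0 hL] := abs_cont_lipschitz hac hM.
(* When [M = 0] the right side is [0] even if an error term is infinite, so infinity gives no
   trivial bound; but then [h] is constant and the left side vanishes. *)
move: (M0); rewrite le_eqVlt => /predU1P[ME|M_gt0].
  have hE x : h x = h 0.
    have := hL x 0; rewrite -ME mul0r normr_le0 subr_eq0.
    by move=> /eqP.
  rewrite -ME mul0e; under eq_integral do rewrite hE.
  under [X in (_ - X)%E]eq_integral do rewrite hE.
  have -> : (\int[P]_t (h 0)%:E = (h 0)%:E)%E.
    by rewrite (EFin_Rintegral (Pintegrable_cst P _)) Rintegral_prob_cst.
  have -> : (\int[Q]_t (h 0)%:E = (h 0)%:E)%E.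
    by rewrite (EFin_Rintegral (Pintegrable_cst Q _)) Rintegral_prob_cst.
  by rewrite subee// abse0.
have [Woo|] := ltP (\int[P]_t (`|W t * r (W t)|)%:E)%E +oo%E; last first.
  rewrite leye_eq => /eqP ->.
  rewrite gt0_muley// addey ?gt0_muley ?leey//.
  by rewrite -ltNye (lt_le_trans ltNy0)// adde_ge0// mule_ge0// lee_fin ltW.
have [Doo|] := ltP (\int[P]_t (`|W t - W' t| ^+ 3)%:E)%E +oo%E; last first.
  rewrite leye_eq => /eqP ->.
  rewrite gt0_muley// addey// addye ?gt0_muley ?leey//.
  by rewrite -ltNye (lt_le_trans ltNy0)// mule_ge0// lee_fin ltW.
have {}Wri := Wri Woo.
have D3i := Pintegrable_ge0 mD3 (fun t => exprn_ge0 3 (normr_ge0 _)) Doo.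
rewrite (EFin_Rintegral (Pintegrable_norm Wri)) (EFin_Rintegral D3i).
have hWi := lipschitz_integrable WW' c0_gt0 Wr Wg2 Wri hL.
have hYi : Pintegrable Q (fun t => h (Y t)).
  have := exponential_shift_integrable YE hL 0.
  by apply: eq_integrable => // t _ /=; rewrite add0r.
rewrite (EFin_Rintegral hWi) (EFin_Rintegral hYi).
rewrite -EFinB -!EFinM lee_fin.
(* Only the drift coefficient differs: [c0] is obtained where [3 * c0] is claimed. *)
apply: (le_trans (wasserstein_bound WW' c0_gt0 Wr Wg2 Wri D3i YE M0 hL)).
rewrite ler_pM2l// -/A lerD2l.
have : 0 <= c0 * \int[P]_t `|W t * r (W t)|.
  by apply: mulr_ge0; [exact: ltW|exact: Rintegral_ge0].
lra.
Qed.
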